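(* $\textsc{Simultaneous}$ is in $P$.
   Context: A game is a pair $(A,B)$ of real $n\times m$ payoff matrices ($A$ for the row player, $B$ for the column player). A subgame is a pair $(I,J)$ with $I\subseteq\{1,\dots,n\}$, $J\subseteq\{1,\dots,m\}$. Simultaneous dominance: $(I,J)\to_{s<}(I\setminus K,J\setminus L)$ if (1) for each $k\in K$ there are $i_k\in I$, $j_k\in J$ with $A_{i_k,j}\ge A_{k,j}$ for all $j\in J$ and $A_{i_k,j_k}>A_{k,j_k}$; (2) for each $l\in L$ there are $i_l\in I$, $j_l\in J$ with $B_{i,j_l}\ge B_{i,l}$ for all $i\in I$ and $B_{i_l,j_l}>B_{i_l,l}$; (3) $K\subseteq I$ and $L\subseteq J$ are maximal among all subsets fulfilling (1) and (2). $\rightrightarrows_{s<}$ is the reflexive transitive closure of $\to_{s<}$. The problem $\textsc{Simultaneous}$ takes an $n\times m$ game $(A,B)$ and a row strategy $1\le i\le n$, and answers yes iff there are $I,J$ with $(\{1,\dots,n\},\{1,\dots,m\})\rightrightarrows_{s<}(I,J)$ and $i\notin I$. *)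

(* Defs.v *)
From HB Require Import structures.
From mathcomp Require Import all_boot all_order all_algebra.
From mathcomp Require Import reals.

Set Implicit Arguments.
Unset Strict Implicit.
Unset Printing Implicit Defensive.

Import Order.TTheory GRing.Theory Num.Theory.

(** * Deterministic multi-tape Turing machines and the class P *)

(** Tapes are infinite in both directions.  The pair [(l, r)] stands for the
    tape whose cells left of the head are [l] (nearest cell first), whose
    scanned cell and the cells right of it are [r], and all of whose other
    cells are blank ([None]). *)
Definition tape (X : Type) : Type := (seq (option X) * seq (option X))%type.

Inductive direction := GoLeft | Stay | GoRight.

Definition tape_read (X : Type) (t : tape X) : option X := head None t.2.

Definition tape_write (X : Type) (a : option X) (t : tape X) : tape X :=
  (t.1, a :: behead t.2).

Definition tape_move (X : Type) (d : direction) (t : tape X) : tape X :=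
  match d with
  | GoLeft => (behead t.1, head None t.1 :: t.2)
  | Stay => t
  | GoRight => (tape_read t :: t.1, behead t.2)
  end.

(** The tape alphabet is the disjoint union of the input alphabet [Sigma], the
    auxiliary alphabet [work] and the blank.  There are [extra.+1] tapes; tape
    [ord0] is the input tape.  A state is halting when its verdict is
    [Some b], with [b] telling acceptance from rejection. *)
Record machine (Sigma : finType) := Machine {
  state : finType;
  work : finType;
  extra : nat;
  start : state;
  verdict : state -> option bool;
  delta : state -> {ffun 'I_extra.+1 -> option (Sigma + work)} ->
          state * ('I_extra.+1 -> option (Sigma + work) * direction)
}.

Definition config (Sigma : finType) (M : machine Sigma) : Type :=
  (state M * ('I_(extra M).+1 -> tape (Sigma + work M)))%type.

Definition init (Sigma : finType) (M : machine Sigma) (w : seq Sigma) :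
    config M :=
  (start M,
   fun i => if i == ord0 then ([::], [seq Some (inl x) | x <- w])
            else ([::], [::])).

(** Halting configurations are fixed points of [step]. *)
Definition step (Sigma : finType) (M : machine Sigma) (c : config M) :
    config M :=
  if verdict c.1 is Some _ then c else
  let a := delta c.1 [ffun i => tape_read (c.2 i)] in
  (a.1, fun i => tape_move (a.2 i).2 (tape_write (a.2 i).1 (c.2 i))).

Definition verdict_after (Sigma : finType) (M : machine Sigma) (t : nat)
    (w : seq Sigma) : option bool :=
  verdict (iter t (@step Sigma M) (init M w)).1.

(** Every polynomial in [n] is bounded by [n ^ k + k] for some [k]. *)
Definition in_P (Sigma : finType) (L : seq Sigma -> Prop) : Prop :=
  exists (M : machine Sigma) (k : nat), forall w : seq Sigma,
    exists b : bool,
      verdict_after M (size w ^ k + k) w = Some b /\ (b <-> L w).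

(** * Simultaneous elimination of dominated strategies *)

Section Game.

Local Open Scope ring_scope.

Variables (R : realType) (n m : nat) (A B : 'M[R]_(n, m)).

Implicit Types (I K : {set 'I_n}) (J L : {set 'I_m}).

Definition row_dominated I J (k : 'I_n) : bool :=
  [exists i in I, exists j0 in J,
     [forall j in J, A i j >= A k j] && (A i j0 > A k j0)].

Definition col_dominated I J (l : 'I_m) : bool :=
  [exists j in J, exists i0 in I,
     [forall i in I, B i j >= B i l] && (B i0 j > B i0 l)].

Definition removable I J K L : bool :=
  [&& K \subset I, L \subset J,
      [forall k in K, row_dominated I J k] &
      [forall l in L, col_dominated I J l]].

Definition max_removable I J K L : bool :=
  removable I J K L &&
  [forall K' : {set 'I_n}, forall L' : {set 'I_m},
     [&& removable I J K' L', K \subset K' & L \subset L'] ==>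
     (K' == K) && (L' == L)].

Definition sim_step : rel ({set 'I_n} * {set 'I_m}) :=
  fun S T => [exists K : {set 'I_n}, exists L : {set 'I_m},
    max_removable S.1 S.2 K L && (T == (S.1 :\: K, S.2 :\: L))].

Definition sim_eliminated (i : 'I_n) : Prop :=
  exists I J, connect sim_step (setT, setT) (I, J) /\ i \notin I.

End Game.

(** * The decision problem

    An instance has to be a finite word, so payoffs are the rational numbers
    among the reals, written as binary fractions.  Fractions need not be in
    lowest terms, and numerals may have leading zeros or be empty (standing for
    0). *)

Inductive symbol := Zero | One | Minus | Slash | Comma | Semicolon | Hash.

Definition symbol_code (s : symbol) : 'I_7 :=
  match s with
  | Zero => inord 0 | One => inord 1 | Minus => inord 2 | Slash => inord 3
  | Comma => inord 4 | Semicolon => inord 5 | Hash => inord 6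
  end.

Definition symbol_decode (i : 'I_7) : symbol :=
  nth Zero [:: Zero; One; Minus; Slash; Comma; Semicolon; Hash] i.

Lemma symbol_codeK : cancel symbol_code symbol_decode.
Proof. by case; rewrite /symbol_decode inordK. Qed.

HB.instance Definition _ := Finite.copy symbol (can_type symbol_codeK).

Record fraction_literal := FractionLiteral {
  lit_neg : bool;
  lit_num : seq bool;
  lit_den : seq bool
}.

(** Most significant bit first. *)
Definition binary_value (s : seq bool) : nat :=
  foldl (fun (acc : nat) (b : bool) => acc.*2 + b) 0 s.

Definition literal_value (R : realType) (f : fraction_literal) : R :=
  ((-1) ^+ lit_neg f * (binary_value (lit_num f))%:R
   / (binary_value (lit_den f))%:R)%R.

Definition proper_literals (n m : nat) (A : 'M[fraction_literal]_(n, m)) :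
    Prop :=
  forall i j, binary_value (lit_den (A i j)) != 0.

Definition encode_numeral (s : seq bool) : seq symbol :=
  [seq if b then One else Zero | b <- s].

Definition encode_literal (f : fraction_literal) : seq symbol :=
  (if lit_neg f then [:: Minus] else [::]) ++
  encode_numeral (lit_num f) ++ Slash :: encode_numeral (lit_den f).

Definition encode_matrix (n m : nat) (A : 'M[fraction_literal]_(n, m)) :
    seq symbol :=
  flatten [seq rcons (flatten [seq rcons (encode_literal (A i j)) Comma
                              | j <- enum 'I_m]) Semicolon
          | i <- enum 'I_n].

(** The row index comes first, in unary and counted from 1; as it is at most
    the number of rows, this does not change the length of an instance by more
    than a constant factor. *)
Definition encode_instance (n m : nat) (A B : 'M[fraction_literal]_(n, m))
    (i : 'I_n) : seq symbol :=
  nseq i.+1 One ++ Hash :: encode_matrix A ++ Hash :: encode_matrix B.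

Definition Simultaneous (R : realType) (w : seq symbol) : Prop :=
  exists (n m : nat) (A B : 'M[fraction_literal]_(n, m)) (i : 'I_n),
    [/\ proper_literals A, proper_literals B, w = encode_instance A B i &
        sim_eliminated (map_mx (@literal_value R) A)
                       (map_mx (@literal_value R) B) i].

(* Main.v *)
Require Import Defs.
From mathcomp Require Import all_boot all_order all_algebra.
From mathcomp Require Import reals zify boolp.

(** The fate of a row is decided by iterating [n + m] times the map that deletes
    all dominated rows and columns: [sim_step] is the graph of this map, and a
    deletion that removes nothing is a fixed point.  Payoffs are compared by
    cross multiplication of binary numerals.  An input is first parsed
    carelessly; it is accepted as well formed if encoding the result gives the
    input back, so that only parsing of correct encodings has to be analysed.

    For the running time, binary trees are written in preorder on the stacks of
    a machine with one stack per tape.  The functions between types of trees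
    that are computable in polynomial time are closed under composition,
    pairing, case distinction, and folding over lists whenever each step
    enlarges the accumulator by an amount that is polynomial in the context and
    the list item alone; the procedure above is an ordinary function built in
    this way. *)

Set Implicit Arguments.
Unset Strict Implicit.
Unset Printing Implicit Defensive.

Import Order.TTheory GRing.Theory Num.Theory.

(** * Stack programs and their simulation by Turing machines *)

(** Functions computable in polynomial time are not closed under iteration: repeating a step that
    doubles the size gives exponential growth. A loop therefore needs a bound on all its
    intermediate values, and the additive growth condition on folds supplies it, since the
    increments sum to at most the length of the list times one polynomial. Rounds of elimination and
    digits of a product both fit this pattern. Preorder is chosen because it is self-delimiting. A
    pair is one bit followed by the concatenated codes of its components, and the end of the first
    component is found by counting, so two bits suffice as auxiliary alphabet. Natural numbers are
    stored in unary. They occur only as indices, lengths and dimensions, which never exceed the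
    input length by much; payoffs can be exponential in it and stay lists of bits throughout. *)

Section StackPrograms.

Variable X : finType.

Inductive cmd :=
| Skip
| Push of nat & X
| Pop of nat
| Seq of cmd & cmd
| If of nat & pred (option X) & cmd & cmd
| While of nat & pred (option X) & cmd.

Definition store := nat -> seq X.

Definition upd (s : store) i v : store := fun j => if j == i then v else s j.

(** The time index is an upper bound for the number of machine steps of the
    compiled program. *)
Inductive exec : cmd -> store -> nat -> store -> Prop :=
| ExecSkip s : exec Skip s 0 s
| ExecPush s i x : exec (Push i x) s 2 (upd s i (x :: s i))
| ExecPop s i : exec (Pop i) s 1 (upd s i (behead (s i)))
| ExecSeq c d s s1 s2 t1 t2 :
    exec c s t1 s1 -> exec d s1 t2 s2 -> exec (Seq c d) s (t1 + t2) s2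
| ExecIfT i (P : pred (option X)) c d s s1 t :
    P (ohead (s i)) -> exec c s t s1 -> exec (If i P c d) s t.+2 s1
| ExecIfF i (P : pred (option X)) c d s s1 t :
    ~~ P (ohead (s i)) -> exec d s t s1 -> exec (If i P c d) s t.+1 s1
| ExecWhileF i (P : pred (option X)) c s :
    ~~ P (ohead (s i)) -> exec (While i P c) s 1 s
| ExecWhileT i (P : pred (option X)) c s s1 s2 t1 t2 :
    P (ohead (s i)) -> exec c s t1 s1 -> exec (While i P c) s1 t2 s2 ->
    exec (While i P c) s (t1 + t2).+2 s2
| ExecWeaken c s t t' s1 : exec c s t s1 -> t <= t' -> exec c s t' s1.

(** No command lengthens a stack by more than the time it takes. Through this, a bound on running
    time also bounds the size of results. *)
Lemma exec_size c s t s1 i : exec c s t s1 -> size (s1 i) <= size (s i) + t.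
Proof.
elim=> {c s t s1} /=; rewrite /upd.
- by move=> s; lia.
- by move=> s j x; case: eqP => [->|_] /=; lia.
- by move=> s j; case: eqP => [->|_]; rewrite ?size_behead; lia.
all: by move=> *; lia.
Qed.

Fixpoint stacks_below (n : nat) (c : cmd) : bool :=
  match c with
  | Skip => true
  | Push i _ | Pop i => i < n
  | Seq c d => stacks_below n c && stacks_below n d
  | If i _ c d => [&& i < n, stacks_below n c & stacks_below n d]
  | While i _ c => (i < n) && stacks_below n c
  end.

Lemma stacks_belowW m n c : m <= n -> stacks_below m c -> stacks_below n c.
Proof.
move=> le_mn; elim: c => //=.
- by move=> i _ /leq_trans; apply.
- by move=> i /leq_trans; apply.
- by move=> c IHc d IHd /andP[/IHc -> /IHd].
- by move=> i _ c IHc d IHd /and3P[/leq_trans -> // /IHc -> /IHd].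
- by move=> i _ c IHc /andP[/leq_trans -> // /IHc].
Qed.

Lemma stacks_below_ex c : exists n, stacks_below n c.
Proof.
elim: c => /=.
- by exists 0.
- by move=> i _; exists i.+1.
- by move=> i; exists i.+1.
- move=> c [m Hc] d [n Hd]; exists (maxn m n).
  by rewrite (stacks_belowW _ Hc) ?(stacks_belowW _ Hd) ?leq_maxl ?leq_maxr.
- move=> i _ c [m Hc] d [n Hd]; exists (maxn i.+1 (maxn m n)).
  rewrite (stacks_belowW _ Hc) ?(stacks_belowW _ Hd); lia.
- move=> i _ c [m Hc]; exists (maxn i.+1 m).
  rewrite (stacks_belowW _ Hc); lia.
Qed.

(** [Act i w d] writes [w] on tape [i] ([None] meaning that the scanned symbol
    is kept) and moves its head; [Jump i P l] continues at address [l] unless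
    the symbol scanned on tape [i] satisfies [P]. *)
Inductive instr :=
| Act of nat & option (option X) & direction
| Jump of nat & pred (option X) & nat.

Fixpoint code_size (c : cmd) : nat :=
  match c with
  | Skip => 0
  | Push _ _ => 2
  | Pop _ => 1
  | Seq c d => code_size c + code_size d
  | If _ _ c d => (code_size c + code_size d).+2
  | While _ _ c => (code_size c).+2
  end.

(** Jump targets are absolute, so [p] is the address at which the code will be placed.
    [Jump 0 pred0 l] is an unconditional jump, as [pred0] never holds. A push takes two instructions
    because the head has to move before it writes. *)
Fixpoint compile (p : nat) (c : cmd) : seq instr :=
  match c with
  | Skip => [::]
  | Push i x => [:: Act i None GoLeft; Act i (Some (Some x)) Stay]
  | Pop i => [:: Act i (Some None) GoRight]
  | Seq c d => compile p c ++ compile (p + code_size c) d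
  | If i P c d =>
      Jump i P (p + code_size c).+2 :: compile p.+1 c ++
      Jump 0 pred0 (p + code_size c + code_size d).+2 ::
      compile (p + code_size c).+2 d
  | While i P c =>
      Jump i P (p + code_size c).+2 :: compile p.+1 c ++ [:: Jump 0 pred0 p]
  end.

Lemma size_compile p c : size (compile p c) = code_size c.
Proof.
elim: c p => //= [c IHc d IHd|i P c IHc d IHd|i P c IHc] p;
  by rewrite ?size_cat /= ?IHc ?IHd /=; lia.
Qed.

End StackPrograms.

Arguments Skip {X}.
Arguments Pop {X}.

(** * Tapes as stacks, and correctness of compilation *)

Section Simulation.

Variable Sigma : finType.

Local Notation X := (Sigma + bool)%type.

Variables (code : seq (instr X)) (extra : nat).

Local Notation pc_state := ('I_(size code).+1 + bool)%type.

Definition at_pc (p : nat) : pc_state := inl (inord p).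

Definition run_instr (ins : instr X) (p : nat)
    (a : {ffun 'I_extra.+1 -> option X}) :
    pc_state * ('I_extra.+1 -> option X * direction) :=
  match ins with
  | Act i w d =>
      (at_pc p.+1,
       fun j => if nat_of_ord j == i then (odflt (a j) w, d) else (a j, Stay))
  | Jump i P l =>
      (at_pc (if P (a (inord i)) then p.+1 else l), fun j => (a j, Stay))
  end.

(** States are program counters together with two verdicts. A counter that has run past the code
    looks at the top of stack 0 and accepts if it is the bit [true]. *)
Definition code_machine : machine Sigma :=
  @Machine Sigma pc_state bool extra (at_pc 0)
    (fun q => if q is inr b then Some b else None)
    (fun q a =>
       match q with
       | inr b => (inr b, fun j => (a j, Stay))
       | inl p =>
           if p < size code then run_instr (nth (Jump 0 pred0 0) code p) p a
           else (inr (a ord0 == Some (inr true)), fun j => (a j, Stay))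
       end).

Local Notation mstep := (@step Sigma code_machine).

(** The top of the stack is under the head, the rest is to the right of it. *)
Definition tape_stack (t : tape X) (s : seq X) : Prop :=
  all (fun x => x == None) t.1 /\
  exists k, t.2 = [seq Some x | x <- s] ++ nseq k None.

Definition tapes_store (tp : 'I_extra.+1 -> tape X) (s : store X) : Prop :=
  forall i, tape_stack (tp i) (s i).

Lemma tape_stack_read t s : tape_stack t s -> tape_read t = ohead s.
Proof.
rewrite /tape_read; case: t => l r [_ [k /= ->]].
by case: s => //=; case: k.
Qed.

(** A machine step writes on every tape. Rewriting the scanned symbol may turn an implicit blank
    into an explicit one, so an untouched tape is preserved only as a representation of its
    stack. *)
Lemma tape_stack_keep t s :
  tape_stack t s -> tape_stack (tape_write (tape_read t) t) s.
Proof.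
case: t => l r [/= Hl [k /= ->]]; split => //=.
by case: s => [|x s] /=; [case: k => [|k]; [exists 1|exists k.+1] | exists k].
Qed.

Lemma tape_stack_pop t s :
  tape_stack t s -> tape_stack (tape_move GoRight (tape_write None t)) (behead s).
Proof.
case: t => l r [/= Hl [k /= ->]]; split => //=.
by case: s => [|x s] /=; [exists k.-1; case: k | exists k].
Qed.

Lemma tape_stack_push t s x :
  tape_stack t s ->
  tape_stack (tape_move Stay (tape_write (Some x)
    (tape_move GoLeft (tape_write (tape_read t) t)))) (x :: s).
Proof.
case: t => l r [/= Hl [k /= ->]]; split => /=; first by case: l Hl => //= y l /andP[].
by case: s => [|y s] /=; [case: k => [|k]; [exists 1|exists k.+1] | exists k].
Qed.

Lemma step_at p tp :
  p < size code ->
  mstep (at_pc p, tp) =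
  let a := run_instr (nth (Jump 0 pred0 0) code p) p
             [ffun i => tape_read (tp i)] in
  (a.1, fun i => tape_move (a.2 i).2 (tape_write (a.2 i).1 (tp i))).
Proof. by move=> ltp; rewrite /step /= inordK ?ltp // leqW. Qed.

Lemma step_act p tp i w d :
  p < size code -> nth (Jump 0 pred0 0) code p = Act i w d ->
  mstep (at_pc p, tp) =
  (at_pc p.+1,
   fun j : 'I_extra.+1 =>
     if nat_of_ord j == i
     then tape_move d (tape_write (odflt (tape_read (tp j)) w) (tp j))
     else tape_write (tape_read (tp j)) (tp j)).
Proof.
move=> ltp Ep; rewrite step_at // Ep /=; congr pair; apply: funext => j.
by rewrite ffunE; case: eqP.
Qed.

Lemma step_jump p tp s i P l :
  p < size code -> nth (Jump 0 pred0 0) code p = Jump i P l -> i <= extra ->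
  tapes_store tp s ->
  exists2 tp', mstep (at_pc p, tp) =
                 (at_pc (if P (ohead (s i)) then p.+1 else l), tp')
             & tapes_store tp' s.
Proof.
move=> ltp Ep lei Hs; rewrite step_at // Ep /= ffunE (tape_stack_read (Hs _)).
rewrite inordK //; eexists; first by reflexivity.
by move=> j; rewrite ffunE; apply/tape_stack_keep/Hs.
Qed.

(** A store determines the tapes only up to explicit blanks, hence the quantification over all tapes
    that represent it; [t] is merely an upper bound. *)
Definition reaches p s t p' s' : Prop :=
  forall tp, tapes_store tp s -> exists t' tp',
    [/\ t' <= t, iter t' mstep (at_pc p, tp) = (at_pc p', tp')
      & tapes_store tp' s'].

Lemma reaches0 p s : reaches p s 0 p s.
Proof. by move=> tp H; exists 0, tp. Qed.

Lemma reaches_trans p1 s1 t1 p2 s2 t2 p3 s3 :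
  reaches p1 s1 t1 p2 s2 -> reaches p2 s2 t2 p3 s3 ->
  reaches p1 s1 (t1 + t2) p3 s3.
Proof.
move=> H1 H2 tp /H1 [t1' [tp1 [le1 E1 /H2[t2' [tp2 [le2 E2 H]]]]]].
exists (t2' + t1'), tp2; split => //; first by lia.
by rewrite iterD E1.
Qed.

Lemma reaches_jump p s i P l :
  p < size code -> nth (Jump 0 pred0 0) code p = Jump i P l -> i <= extra ->
  reaches p s 1 (if P (ohead (s i)) then p.+1 else l) s.
Proof.
by move=> ltp Ep lei tp /(step_jump ltp Ep lei)[tp' E H]; exists 1, tp'.
Qed.

Lemma nth_mid (pre post : seq (instr X)) i :
  code = pre ++ i :: post ->
  size pre < size code /\ nth (Jump 0 pred0 0) code (size pre) = i.
Proof. by move=> ->; rewrite nth_cat ltnn subnn size_cat /=; split; first lia. Qed.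

(** Induction on the execution. The surrounding code [pre] and [post] is arbitrary, so that the
    induction hypotheses apply to subprograms inside the same fixed code. *)
Lemma compile_reaches c s t s' (pre post : seq (instr X)) :
  exec c s t s' -> stacks_below extra.+1 c ->
  code = pre ++ compile (size pre) c ++ post ->
  reaches (size pre) s t (size pre + code_size c) s'.
Proof.
move=> E; elim: E pre post => {c s t s'} /=.
- by move=> s pre post _ _; rewrite addn0; apply: reaches0.
- move=> s i x pre post lti /[dup] Ec.
  rewrite -cat1s catA => /nth_mid[].
  rewrite size_cat /= addn1 => lt2 E2.
  case: (nth_mid Ec) => lt1 E1 tp Hs.
  eexists 2, _; split => //=.
    by rewrite (step_act _ lt1 E1) (step_act _ lt2 E2) addn2.
  move=> j; rewrite /upd /=.
  by case: eqP => [<-|_] /=; [apply: tape_stack_push | do 2!apply: tape_stack_keep].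
- move=> s i pre post lti /nth_mid[lt1 E1] tp Hs.
  eexists 1, _; split => //=; first by rewrite (step_act _ lt1 E1) addn1.
  move=> j; rewrite /upd /=.
  by case: eqP => [<-|_] /=; [apply: tape_stack_pop | apply: tape_stack_keep].
- move=> c d s s1 s2 t1 t2 _ IHc _ IHd pre post /andP[bc bd] Ec.
  apply: reaches_trans (IHc pre _ bc _) _; first by rewrite Ec -catA.
  have := IHd (pre ++ compile (size pre) c) post bd.
  rewrite size_cat size_compile addnA; apply.
  by rewrite Ec !catA.
- move=> i P c d s s1 t HP _ IHc pre post /and3P[lti bc bd] Ec.
  have [lt1 E1] := nth_mid Ec.
  (* The test, the first branch, and the jump over the second branch. *)
  have -> : t.+2 = 1 + (t + 1) by lia.
  apply: (reaches_trans (reaches_jump lt1 E1 _)) => //.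
  rewrite HP; apply: (@reaches_trans _ _ _ ((size pre).+1 + code_size c) s1).
    have := IHc (rcons pre (Jump i P (size pre + code_size c).+2)) _ bc.
    by rewrite size_rcons; apply; rewrite cat_rcons Ec /= -catA.
  have := @nth_mid (pre ++ Jump i P (size pre + code_size c).+2 ::
              compile (size pre).+1 c)
            (compile (size pre + code_size c).+2 d ++ post)
            (Jump 0 pred0 (size pre + code_size c + code_size d).+2).
  rewrite size_cat /= size_compile.
  case; first by rewrite Ec /= -?catA /= -?catA.
  rewrite addnS -addSn => lt2 E2.
  have := reaches_jump (s := s1) lt2 E2 (leq0n _).
  by rewrite /= !addnS addnA.
- move=> i P c d s s1 t HP _ IHd pre post /and3P[lti bc bd] Ec.
  have [lt1 E1] := nth_mid Ec.
  rewrite -[t.+1]/(1 + t); apply: (reaches_trans (reaches_jump lt1 E1 _)) => //.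
  rewrite (negPf HP).
  have := IHd (pre ++ Jump i P (size pre + code_size c).+2 ::
     compile (size pre).+1 c ++ [:: Jump 0 pred0 (size pre + code_size c + code_size d).+2])
     post bd.
  rewrite size_cat /= size_cat /= size_compile addn1 !addnS addSn addnA.
  by apply; rewrite Ec /= -?catA /= -?catA.
- move=> i P c s HP pre post /andP[lti bc] Ec.
  have [lt1 E1] := nth_mid Ec.
  have := reaches_jump (s := s) lt1 E1 lti.
  by rewrite (negPf HP) !addnS.
- move=> i P c s s1 s2 t1 t2 HP _ IHc _ IHw pre post /[dup] bw /andP[lti bc] Ec.
  have [lt1 E1] := nth_mid Ec.
  (* The test, one pass of the body, the jump back, and then the rest of the loop, which starts
     again at the same address. *)
  have -> : (t1 + t2).+2 = 1 + (t1 + (1 + t2)) by lia.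
  apply: (reaches_trans (reaches_jump lt1 E1 _)) => //; rewrite HP.
  apply: (@reaches_trans _ _ _ ((size pre).+1 + code_size c) s1).
    have := IHc (rcons pre (Jump i P (size pre + code_size c).+2)) _ bc.
    by rewrite size_rcons; apply; rewrite cat_rcons Ec /= -catA.
  apply: reaches_trans (IHw pre post bw Ec).
  have := @nth_mid (pre ++ Jump i P (size pre + code_size c).+2 ::
              compile (size pre).+1 c) post (Jump 0 pred0 (size pre)).
  rewrite size_cat /= size_compile.
  case; first by rewrite Ec /= -?catA /= -?catA /=.
  rewrite addnS -addSn => lt2 E2.
  exact: (reaches_jump (s := s1) lt2 E2 (leq0n _)).
- move=> c s t t' s1 _ IH le_t pre post bc Ec tp /(IH _ _ bc Ec)[u [tp' [le_u ? ?]]].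
  by exists u, tp'; split => //; apply: leq_trans le_t.
Qed.

End Simulation.

(** Membership in P reads the verdict at one prescribed time, whereas programs come with upper
    bounds; a machine that has halted bridges the gap by standing still. *)
Lemma iter_verdict (Sigma : finType) (M : machine Sigma) t t' w b :
  verdict_after M t w = Some b -> t <= t' -> verdict_after M t' w = Some b.
Proof.
rewrite /verdict_after => E le_t; rewrite -(subnK le_t) iterD.
elim: (t' - t) => [|u IHu]; first exact: E.
by rewrite iterS {1}/step IHu.

Qed.

Lemma exec_verdict (Sigma : finType) (c : cmd (Sigma + bool)%type) :
  exists M : machine Sigma, forall w t s,
    exec c (fun i => if i == 0 then [seq inl x | x <- w] else [::]) t s ->
    verdict_after M t.+1 w = Some (ohead (s 0) == Some (inr true)).
Proof.
have [n Hn] := stacks_below_ex c.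
exists (code_machine (compile 0 c) n) => w t s E.
have := @compile_reaches Sigma (compile 0 c) n c _ t s [::] [::] E.
rewrite cats0 => /(_ (stacks_belowW (leqnSn n) Hn) erefl).
move=> /(_ (init (code_machine (compile 0 c) n) w).2) [].
  move=> i; rewrite /init /= -val_eqE /=; case: eqP => _; last by split => //; exists 0.
  by split => //; exists 0; rewrite cats0 -map_comp.
move=> t' [tp [le_t Et Hs]].
apply: (@iter_verdict _ _ t'.+1); last by lia.
rewrite /verdict_after iterS Et /step /= inordK ?size_compile ?add0n ?ltnn //=.
have -> : (code_size c < size (compile 0 c)) = false by rewrite size_compile ltnn.
by rewrite /= ffunE (tape_stack_read (Hs ord0)).
Qed.

(** * Stacks holding trees in preorder *)

(** The base is at least 2, so raising the exponent by one absorbs a sum of two bounds, and a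
    constant [c] is below the power with exponent [c]. *)
Definition poly_bounded (p : nat -> nat) := exists k, forall n, p n <= n.+2 ^ k.

Lemma poly_bounded_exp k : poly_bounded (fun n => n.+2 ^ k).
Proof. by exists k. Qed.

Lemma poly_bounded_id : poly_bounded id.
Proof. by exists 1 => n; rewrite expn1; lia. Qed.

Lemma poly_bounded_const c : poly_bounded (fun=> c).
Proof.
exists c => n; case: c => // c.
by apply: leq_trans (ltnW (ltn_expl c.+1 (ltnSn 1))) _; rewrite leq_exp2r.
Qed.

Lemma poly_bounded_add p q :
  poly_bounded p -> poly_bounded q -> poly_bounded (fun n => p n + q n).
Proof.
move=> [k Hp] [l Hq]; exists (maxn k l).+1 => n.
rewrite expnS; apply: (@leq_trans (2 * n.+2 ^ maxn k l)); last by rewrite leq_mul2r orbC.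
rewrite mul2n -addnn; apply: leq_add.
  by apply: leq_trans (Hp n) _; rewrite leq_exp2l ?leq_maxl.
by apply: leq_trans (Hq n) _; rewrite leq_exp2l ?leq_maxr.
Qed.

Lemma poly_bounded_mul p q :
  poly_bounded p -> poly_bounded q -> poly_bounded (fun n => p n * q n).
Proof. by move=> [k Hp] [l Hq]; exists (k + l) => n; rewrite expnD leq_mul. Qed.

Lemma poly_bounded_succ p : poly_bounded p -> poly_bounded (fun n => (p n).+1).
Proof.
move=> Hp; have [k Hk] := poly_bounded_add Hp (poly_bounded_const 1).
by exists k => n; rewrite -addn1.
Qed.

Lemma poly_bounded_expn p k :
  poly_bounded p -> poly_bounded (fun n => p n ^ k).
Proof.
move=> [l Hp]; exists (l * k) => n; rewrite expnM.
by case: k => // k; rewrite leq_exp2r.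
Qed.

Ltac poly_bounded := repeat first
  [ exact: poly_bounded_id | exact: poly_bounded_const | exact: poly_bounded_exp
  | apply: poly_bounded_succ | apply: poly_bounded_add
  | apply: poly_bounded_mul | apply: poly_bounded_expn ].

Inductive tree := Leaf | Node of tree & tree.

Fixpoint preorder (t : tree) : seq bool :=
  if t is Node l r then true :: preorder l ++ preorder r else [:: false].

(** [default] fills the places where a program takes the head of a list that may be empty. *)
Class Data (A : Type) := { encode : A -> tree; default : A }.
#[export] Hint Mode Data ! : typeclass_instances.

Definition bits A `{Data A} (a : A) := preorder (encode a).
Definition bsize A `{Data A} (a : A) := size (bits a).

Fixpoint list_tree A (e : A -> tree) (l : seq A) : tree :=
  if l is a :: l' then Node (e a) (list_tree e l') else Leaf.

#[export] Instance data_bool : Data bool :=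
  {| encode b := if b then Node Leaf Leaf else Leaf; default := false |}.
#[export] Instance data_unit : Data unit :=
  {| encode _ := Leaf; default := tt |}.
(** The tree of [n] is literally that of a list of [n] units, or of [n] bits [false]. Conversions
    between numbers and such lists cost nothing, and loops of given length become folds. *)
#[export] Instance data_nat : Data nat :=
  {| encode n := iter n (Node Leaf) Leaf; default := 0 |}.
#[export] Instance data_seq A `{Data A} : Data (seq A) :=
  {| encode := list_tree encode; default := [::] |}.
#[export] Instance data_prod A B `{Data A} `{Data B} : Data (A * B) :=
  {| encode p := Node (encode p.1) (encode p.2); default := (default, default) |}.

Lemma bsize_pair A B `{Data A} `{Data B} (a : A) (b : B) :
  bsize (a, b) = (bsize a + bsize b).+1.
Proof. by rewrite /bsize /bits /= size_cat. Qed.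

Lemma bsize_cons A `{Data A} (a : A) l : bsize (a :: l) = (bsize a + bsize l).+1.
Proof. by rewrite /bsize /bits /= size_cat. Qed.

Lemma bsize_nil A `{Data A} : bsize ([::] : seq A) = 1.
Proof. by []. Qed.

Lemma bsize_gt0 A `{Data A} (a : A) : 0 < bsize a.
Proof. by rewrite /bsize /bits; case: (encode a). Qed.

Lemma bsize_bool (b : bool) : bsize b <= 3.
Proof. by case: b. Qed.

(** * Basic stack manipulations *)

Section Layout.

Variable Sigma : finType.
Local Notation X := (Sigma + bool)%type.
Implicit Types (s : store X) (b i j k : nat) (ss : seq (seq bool)) (u v : seq bool).

(** Stacks below [b] belong to the caller and are taken from [s]; those past the end of [ss] are
    empty, so trailing empty entries of [ss] make no difference. *)
Definition layout b s ss : store X :=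
  fun j => if j < b then s j else [seq inr x | x <- nth [::] ss (j - b)].

Lemma layout_get b s ss i : layout b s ss (b + i) = [seq inr x | x <- nth [::] ss i].
Proof. by rewrite /layout ltnNge leq_addr addKn. Qed.

Lemma layout_upd b s ss i u :
  upd (layout b s ss) (b + i) [seq inr x | x <- u] =
  layout b s (set_nth [::] ss i u).
Proof.
apply: funext => j; rewrite /upd /layout nth_set_nth /=.
case: ifP => [/eqP -> | /eqP ne]; first by rewrite ltnNge leq_addr addKn eqxx.
by case: ltnP => // le_bj; case: eqP => // E; case: ne; lia.
Qed.

Lemma eq_layout b s ss ss' :
  (forall i, nth [::] ss i = nth [::] ss' i) -> layout b s ss = layout b s ss'.
Proof. by move=> E; apply: funext => j; rewrite /layout E. Qed.

(** The frame rule: a subprogram started at [b + 1] sees stack [b] as private data of its caller and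
    leaves it alone. *)
Lemma layout_cons b s u ss :
  layout b s (u :: ss) = layout (b + 1) (layout b s [:: u]) ss.
Proof.
apply: funext => j; rewrite /layout addn1 ltnS.
case: (ltngtP j b) => [//|lt_bj|->]; last by rewrite subnn.
by rewrite -(subnSK lt_bj).
Qed.

Definition on_true (o : option X) := o == Some (inr true).
Definition on_some (o : option X) : bool := o.

Lemma on_true_layout b s ss i :
  on_true (ohead (layout b s ss (b + i))) = (ohead (nth [::] ss i) == Some true).
Proof. by rewrite layout_get; case: (nth _ _ _). Qed.

Lemma on_some_layout b s ss i :
  on_some (ohead (layout b s ss (b + i))) = ~~ nilp (nth [::] ss i).
Proof. by rewrite layout_get; case: (nth _ _ _). Qed.

Lemma exec_push b s ss i x :
  exec (Push (b + i) (inr x)) (layout b s ss) 2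
       (layout b s (set_nth [::] ss i (x :: nth [::] ss i))).
Proof. by rewrite -layout_upd /= -(layout_get b s); constructor. Qed.

Lemma exec_pop b s ss i :
  exec (Pop (b + i)) (layout b s ss) 1
       (layout b s (set_nth [::] ss i (behead (nth [::] ss i)))).
Proof. by rewrite -layout_upd -behead_map -(layout_get b s); constructor. Qed.

Lemma exec_eq c (s s1 s1' : store X) t t' :
  exec c s t s1 -> s1 = s1' -> t <= t' -> exec c s t' s1'.
Proof. by move=> E <-; apply: ExecWeaken. Qed.

Definition clear i : cmd X := While i on_some (Pop i).

Lemma exec_clear b s ss i u :
  nth [::] ss i = u ->
  exec (clear (b + i)) (layout b s ss) (3 * size u).+1
       (layout b s (set_nth [::] ss i [::])).
Proof.
elim: u ss => [|x u IH] ss E.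
  have -> : layout b s (set_nth [::] ss i [::]) = layout b s ss.
    by apply: eq_layout => j; rewrite nth_set_nth /=; case: eqP => // ->.
  by apply: ExecWhileF; rewrite on_some_layout E.
have := IH (set_nth [::] ss i u); rewrite nth_set_nth /= eqxx set_set_nth eqxx.
move=> /(_ erefl) H; apply: (@ExecWeaken _ _ _ (1 + (3 * size u).+1).+2); last by rewrite /=; lia.
apply: ExecWhileT H; first by rewrite on_some_layout E.
by have := exec_pop b s ss i; rewrite E.
Qed.

Definition push_all i u : cmd X :=
  foldr (fun x c => Seq c (Push i (inr x))) Skip u.

Lemma exec_push_all i u s :
  exec (push_all i u) s (2 * size u) (upd s i ([seq inr x | x <- u] ++ s i)).
Proof.
elim: u => [|x u IH] /=.
  have -> : upd s i (s i) = s.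
    by apply: funext => j; rewrite /upd; case: eqP => // ->.
  exact: ExecSkip.
apply: (exec_eq (ExecSeq IH (ExecPush _ _ _))); last by lia.
by apply: funext => j; rewrite /upd eqxx; case: eqP.
Qed.

Lemma exec_push_all_layout b s ss i u :
  exec (push_all (b + i) u) (layout b s ss) (2 * size u)
       (layout b s (set_nth [::] ss i (u ++ nth [::] ss i))).
Proof. by rewrite -layout_upd map_cat -(layout_get b s); apply: exec_push_all. Qed.

(** Commands have no variable for a symbol, so the branch taken remembers the popped bit. Each
    transfer reverses the order. *)
Definition move_to i (js : seq nat) : cmd X :=
  While i on_some
    (If i on_true
       (Seq (Pop i) (foldr (fun j c => Seq (Push j (inr true)) c) Skip js))
       (Seq (Pop i) (foldr (fun j c => Seq (Push j (inr false)) c) Skip js))).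

Lemma exec_move b s ss i j u :
  nth [::] ss i = u -> i != j ->
  exec (move_to (b + i) [:: b + j]) (layout b s ss) (7 * size u).+1
       (layout b s (set_nth [::] (set_nth [::] ss j (catrev u (nth [::] ss j)))
                      i [::])).
Proof.
move=> + ne_ij; elim: u ss => [|x u IH] ss E.
  have -> : layout b s (set_nth [::] (set_nth [::] ss j (catrev [::] (nth [::] ss j))) i [::])
            = layout b s ss.
    apply: eq_layout => k; rewrite !nth_set_nth /= nth_set_nth /=.
    by case: eqP => [->|_]; last case: eqP => [->|].
  by apply: ExecWhileF; rewrite on_some_layout E.
have := IH (set_nth [::] (set_nth [::] ss i u) j (x :: nth [::] ss j)).
rewrite !nth_set_nth /= nth_set_nth /= (negPf ne_ij) !eqxx => /(_ erefl) H.
apply: (@ExecWeaken _ _ _ (5 + (7 * size u).+1).+2); last by rewrite /=; lia.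
apply: (@ExecWhileT _ _ _ _ _
  (layout b s (set_nth [::] (set_nth [::] ss i u) j (x :: nth [::] ss j)))).
- by rewrite on_some_layout E.
- have H1 : exec (Seq (Pop (b + i)) (Seq (Push (b + j) (inr x)) Skip))
     (layout b s ss) 3
     (layout b s (set_nth [::] (set_nth [::] ss i u) j (x :: nth [::] ss j))).
    apply: (ExecSeq (t1 := 1) (t2 := 2)); first exact: exec_pop.
    apply: (ExecSeq (t1 := 2) (t2 := 0)); last exact: ExecSkip.
    have := exec_push b s (set_nth [::] ss i u) j x.
    by rewrite E nth_set_nth /= eq_sym (negPf ne_ij).
  case: x E H H1 => E _ H1.
    by apply: (ExecIfT _ _ H1); rewrite on_true_layout E.
  apply: (@ExecWeaken _ _ _ 4) => //.
  by apply: (ExecIfF _ _ H1); rewrite on_true_layout E.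
- apply: exec_eq H _ _ => //; apply: eq_layout => k.
  do 4!rewrite ?nth_set_nth /=.
  by case: (k =P i) => // _; case: (k =P j) => // _.
Qed.

End Layout.

Arguments on_true {Sigma}.
Arguments on_some {Sigma}.
Arguments clear {Sigma}.
Arguments push_all {Sigma}.
Arguments move_to {Sigma}.

(** * Closure properties of polynomial-time functions *)

Section PolynomialTime.

Variable Sigma : finType.
Local Notation X := (Sigma + bool)%type.
Implicit Types (s : store X) (b : nat) (u v w : seq bool).

(** The program gets the number [b] of the first stack it may use, so that a
    caller can keep its own data on lower stacks. *)
Definition ptime A B `{Data A} `{Data B} (f : A -> B) : Prop :=
  exists (c : nat -> cmd X) (k : nat), forall b s a,
    exec (c b) (layout b s [:: bits a]) ((bsize a).+2 ^ k)
         (layout b s [:: bits (f a)]).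

Lemma ptime_intro A B `{Data A} `{Data B} (f : A -> B) (c : nat -> cmd X) p :
  poly_bounded p ->
  (forall b s a, exec (c b) (layout b s [:: bits a]) (p (bsize a))
                      (layout b s [:: bits (f a)])) ->
  ptime f.
Proof.
move=> [k Hk] Hf; exists c, k => b s a.
exact: ExecWeaken (Hf b s a) (Hk _).
Qed.

Lemma eq_ptime A B `{Data A} `{Data B} (f g : A -> B) :
  f =1 g -> ptime f -> ptime g.
Proof.
by move=> E [c [k Hf]]; exists c, k => b s a; rewrite -E.
Qed.

(** The output is at most as long as the input plus the time spent, which is what makes composition
    possible. *)
Lemma ptime_size A B `{Data A} `{Data B} (f : A -> B) :
  ptime f -> exists k, forall a, bsize (f a) <= (bsize a).+2 ^ k.
Proof.
move=> [c [k Hf]].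
have [l Hl] := poly_bounded_add poly_bounded_id (poly_bounded_exp k).
exists l => a; apply: leq_trans (Hl _).
have := exec_size 0 (Hf 0 (fun=> [::]) a).
by rewrite /layout /= !size_map.
Qed.

Definition copy b : cmd X :=
  Seq (move_to (b + 0) [:: b + 2]) (move_to (b + 2) [:: b + 0; b + 1]).

Lemma exec_move2 b s u v w :
  exec (move_to (b + 2) [:: b + 0; b + 1]) (layout b s [:: u; v; w])
    (9 * size w).+1 (layout b s [:: catrev w u; catrev w v]).
Proof.
elim: w u v => [|x w IH] u v /=.
  apply: (@exec_eq _ _ _ _ _ 1).
  - by apply: ExecWhileF; rewrite on_some_layout.
  - by apply: eq_layout; do 4?case.
  - by lia.
apply: (@ExecWeaken _ _ _ (7 + (9 * size w).+1).+2); last by lia.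
apply: ExecWhileT (IH (x :: u) (x :: v)); first by rewrite on_some_layout.
have S1 : exec (Seq (Pop (b + 2))
    (Seq (Push (b + 0) (inr x)) (Seq (Push (b + 1) (inr x)) Skip)))
    (layout b s [:: u; v; x :: w]) 5 (layout b s [:: x :: u; x :: v; w]).
  apply: (ExecSeq (t1 := 1) (t2 := 4)); first exact: exec_pop.
  apply: (ExecSeq (t1 := 2) (t2 := 2)); first exact: exec_push.
  apply: (ExecSeq (t1 := 2) (t2 := 0)); last exact: ExecSkip.
  exact: exec_push.
case: x S1 => S1; first by apply: (ExecIfT _ _ S1); rewrite on_true_layout.
apply: (@ExecWeaken _ _ _ 6) => //.
by apply: (ExecIfF _ _ S1); rewrite on_true_layout.
Qed.

Lemma exec_copy b s u :
  exec (copy b) (layout b s [:: u]) (16 * size u + 2) (layout b s [:: u; u]).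
Proof.
pose proof (@exec_move Sigma b s [:: u] 0 2 u erefl isT) as S1.
pose proof (exec_move2 b s [::] [::] (catrev u [::])) as S2.
apply: exec_eq (ExecSeq S1 S2) _ _; last by rewrite !catrevE cats0 size_rev; lia.
by rewrite -/(rev u) -/(rev (rev u)) revK.
Qed.

Definition swap b : cmd X :=
  Seq (Seq (move_to (b + 0) [:: b + 2]) (move_to (b + 1) [:: b + 3]))
      (Seq (move_to (b + 2) [:: b + 1]) (move_to (b + 3) [:: b + 0])).

Lemma exec_swap b s u v :
  exec (swap b) (layout b s [:: u; v]) (14 * size u + 14 * size v + 4)
       (layout b s [:: v; u]).
Proof.
pose proof (@exec_move Sigma b s [:: u; v] 0 2 u erefl isT) as S1.
pose proof (@exec_move Sigma b s [:: [::]; v; rev u] 1 3 v erefl isT) as S2.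
pose proof (@exec_move Sigma b s [:: [::]; [::]; rev u; rev v] 2 1 _ erefl isT) as S3.
pose proof (@exec_move Sigma b s [:: [::]; u; [::]; rev v] 3 0 _ erefl isT) as S4.
rewrite /= -!/(rev _) !revK in S1 S2 S3 S4.
apply: exec_eq (ExecSeq (ExecSeq S1 S2) (ExecSeq S3 S4)) _ _.
  by apply: eq_layout; do 5?case.
by rewrite !size_rev; lia.
Qed.

Lemma ptime_cast A B `{Data A} `{Data B} (f : A -> B) :
  (forall a, encode (f a) = encode a) -> ptime f.
Proof.
move=> E; exists (fun=> Skip), 0 => b s a.
by rewrite /bits E; apply: ExecWeaken; first exact: ExecSkip.
Qed.

Lemma ptime_id A `{Data A} : ptime (fun a : A => a).
Proof. exact: ptime_cast. Qed.

Lemma ptime_const A B `{Data A} `{Data B} (y : B) : ptime (fun _ : A => y).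
Proof.
apply: (@ptime_intro _ _ _ _ _
  (fun b => Seq (clear (b + 0)) (push_all (b + 0) (bits y)))
  (fun n => (3 * n).+1 + 2 * bsize y)); first by poly_bounded.
move=> b s a; apply: ExecSeq; first exact: exec_clear erefl.
apply: exec_eq (exec_push_all_layout _ _ _ _ _) _ _ => //=.
by rewrite cats0.
Qed.

Lemma ptime_comp A B C `{Data A} `{Data B} `{Data C} (g : B -> C) (f : A -> B) :
  ptime g -> ptime f -> ptime (fun a => g (f a)).
Proof.
move=> [d [l Hg]] Hf; have [m Hm] := ptime_size Hf; case: Hf => c [k Hf].
apply: (@ptime_intro _ _ _ _ _ (fun b => Seq (c b) (d b))
  (fun n => n.+2 ^ k + (n.+2 ^ m).+2 ^ l)); first by poly_bounded.
move=> b s a; apply: ExecSeq (Hf b s a) _.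
apply: ExecWeaken (Hg b s (f a)) _.
by case: l Hg => // l _; rewrite leq_exp2r // !ltnS.
Qed.

(** [g] runs on a copy stacked above the original; after a swap [f] runs on the original above the
    result of [g]. Moving the code of [f a] twice puts it, unreversed, in front of that of [g a],
    and a final [true] makes the node. The factor 100 is slack for the linear costs. *)
Lemma ptime_pair A B C `{Data A} `{Data B} `{Data C} (f : A -> B) (g : A -> C) :
  ptime f -> ptime g -> ptime (fun a => (f a, g a)).
Proof.
move=> Hf Hg; have [m Hm] := ptime_size Hf; have [m' Hm'] := ptime_size Hg.
case: Hf => c [k Hf]; case: Hg => d [l Hg].
apply: (@ptime_intro _ _ _ _ _ (fun b => Seq (copy b) (Seq (d (b + 1))
   (Seq (swap b) (Seq (c (b + 1)) (Seq (move_to (b + 1) [:: b + 2])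
   (Seq (move_to (b + 2) [:: b + 0]) (Push (b + 0) (inr true))))))))
  (fun n => 100 * (n + n.+2 ^ m + n.+2 ^ m' + n.+2 ^ k + n.+2 ^ l + 1))).
  by poly_bounded.
move=> b s a.
pose proof (exec_copy b s (bits a)) as S1.
pose proof (Hg (b + 1) (layout b s [:: bits a]) a) as S2.
pose proof (exec_swap b s (bits a) (bits (g a))) as S3.
pose proof (Hf (b + 1) (layout b s [:: bits (g a)]) a) as S4.
rewrite -!layout_cons in S2 S4.
pose proof (@exec_move Sigma b s [:: bits (g a); bits (f a)] 1 2 _ erefl isT) as S5.
pose proof (@exec_move Sigma b s [:: bits (g a); [::]; rev (bits (f a))] 2 0 _ erefl isT) as S6.
rewrite /= -!/(rev _) in S5.
rewrite /= catrevE revK size_rev in S6.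
pose proof (exec_push b s [:: bits (f a) ++ bits (g a); [::]; [::]] 0 true) as S7.
apply: exec_eq (ExecSeq S1 (ExecSeq S2 (ExecSeq S3 (ExecSeq S4 (ExecSeq S5
  (ExecSeq S6 S7)))))) _ _.
  by apply: eq_layout; do 4?case.
have := Hm a; have := Hm' a; rewrite /bsize.
set F := size (bits (f a)); set G := size (bits (g a)); set N := size (bits a).
set n1 := _ ^ m; set n2 := _ ^ m'; set n3 := _ ^ k; set n4 := _ ^ l; lia.
Qed.

Lemma ptime_if A B `{Data A} `{Data B} (t : A -> bool) (f g : A -> B) :
  ptime t -> ptime f -> ptime g -> ptime (fun a => if t a then f a else g a).
Proof.
move=> [e [j Ht]] [c [k Hf]] [d [l Hg]].
apply: (@ptime_intro _ _ _ _ _ (fun b => Seq (copy b) (Seq (e (b + 1))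
   (If (b + 1) on_true (Seq (clear (b + 1)) (c b))
                         (Seq (clear (b + 1)) (d b)))))
  (fun n => 100 * (n + n.+2 ^ j + n.+2 ^ k + n.+2 ^ l + 1))).
  by poly_bounded.
move=> b s a.
pose proof (exec_copy b s (bits a)) as S1.
pose proof (Ht (b + 1) (layout b s [:: bits a]) a) as S2.
rewrite -!layout_cons in S2.
pose proof (@exec_clear Sigma b s [:: bits a; bits (t a)] 1 _ erefl) as S3.
have E : layout b s [:: bits a; [::]] = layout b s [:: bits a].
  by apply: eq_layout; do 3?case.
rewrite /= E in S3; have /= Sb := bsize_bool (t a).
apply: (@ExecWeaken _ _ _ ((16 * size (bits a) + 2) + ((bsize a).+2 ^ j +
   (10 + ((bsize a).+2 ^ k + (bsize a).+2 ^ l + 2))))); last first.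
  by rewrite /bsize; set n1 := _ ^ j; set n2 := _ ^ k; set n3 := _ ^ l; lia.
apply: ExecSeq S1 _; apply: ExecSeq S2 _; rewrite /bsize in Sb.
have Ta : on_true (ohead (layout b s [:: bits a; bits (t a)] (b + 1))) = t a.
  by rewrite on_true_layout /=; case: (t a).
case: (t a) Ta S3 Sb => Ta S3 Sb.
  apply: (@ExecWeaken _ _ _ ((3 * size (bits true)).+1 + (bsize a).+2 ^ k).+2).
    by apply: (ExecIfT _ _ (ExecSeq S3 (Hf b s a))); rewrite Ta.
  by lia.
apply: (@ExecWeaken _ _ _ ((3 * size (bits false)).+1 + (bsize a).+2 ^ l).+1).
  by apply: (ExecIfF _ _ (ExecSeq S3 (Hg b s a))); rewrite Ta.
by lia.
Qed.

(** In preorder a [true] replaces one awaited tree by two and a [false] completes one, so a unary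
    counter detects where a tree ends. The tree arrives reversed. *)
Definition skip_tree b : cmd X :=
  While (b + 2) on_some
    (If (b + 0) on_true
      (Seq (Pop (b + 0)) (Seq (Push (b + 1) (inr true)) (Push (b + 2) (inr true))))
      (Seq (Pop (b + 0)) (Seq (Push (b + 1) (inr false)) (Pop (b + 2))))).

(** Stack [b + 2] counts the trees still to be moved from [b] to [b + 1]. *)
Lemma exec_skip_tree b s t u v w T s' :
  exec (skip_tree b) (layout b s [:: u; catrev (preorder t) v; w]) T s' ->
  exec (skip_tree b) (layout b s [:: preorder t ++ u; v; true :: w])
    (9 * size (preorder t) + T) s'.
Proof.
elim: t u v w T => [|l IHl r IHr] u v w T /= H.
  apply: (@ExecWeaken _ _ _ (6 + T).+2) => //.
  apply: ExecWhileT H; first by rewrite on_some_layout.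
  apply: ExecIfF; first by rewrite on_true_layout.
  apply: (ExecSeq (t1 := 1) (t2 := 4)); first exact: exec_pop.
  apply: (ExecSeq (t1 := 2) (t2 := 2)); first exact: exec_push.
  by apply: ExecWeaken; first exact: exec_pop.
rewrite catrev_catl in H; rewrite -catA.
(* The execution after the tree is a premise of the lemma, so the hypotheses for the two subtrees
   simply compose. *)
have {}H := IHl _ _ _ _ (IHr _ _ _ _ H).
rewrite size_cat.
apply: (@ExecWeaken _ _ _
  (7 + (9 * size (preorder l) + (9 * size (preorder r) + T))).+2); last by lia.
apply: ExecWhileT H; first by rewrite on_some_layout.
apply: ExecIfT; first by rewrite on_true_layout.
apply: (ExecSeq (t1 := 1) (t2 := 4)); first exact: exec_pop.
apply: (ExecSeq (t1 := 2) (t2 := 2)); first exact: exec_push.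
exact: exec_push.
Qed.

Definition split_pair b : cmd X :=
  Seq (Pop (b + 0)) (Seq (Push (b + 2) (inr true)) (skip_tree b)).

Lemma exec_split_pair b s l r :
  exec (split_pair b) (layout b s [:: preorder (Node l r)])
    (9 * size (preorder l) + 4)
    (layout b s [:: preorder r; rev (preorder l)]).
Proof.
pose proof (exec_pop b s [:: preorder (Node l r)] 0) as S1.
pose proof (exec_push b s [:: preorder l ++ preorder r] 2 true) as S2.
have S3 : exec (skip_tree b) (layout b s [:: preorder r; catrev (preorder l) [::]; [::]])
    1 (layout b s [:: preorder r; rev (preorder l)]).
  apply: (@exec_eq _ _ _ _ _ 1).
  - by apply: ExecWhileF; rewrite on_some_layout.
  - by apply: eq_layout; do 4?case.
  - by [].
have {}S3 := exec_skip_tree S3.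
by apply: ExecWeaken (ExecSeq S1 (ExecSeq S2 S3)) _; lia.
Qed.

(** One program serves first projections and heads of lists, both being left subtrees; [d] is the
    answer on the empty list. *)
Lemma ptime_car A B `{Data A} `{Data B} (f : A -> B) (d : B) :
  (forall a, if encode a is Node l _ then encode (f a) = l else f a = d) ->
  ptime f.
Proof.
move=> Hf.
apply: (@ptime_intro _ _ _ _ _ (fun b => If (b + 0) on_true
   (Seq (split_pair b) (Seq (clear (b + 0)) (move_to (b + 1) [:: b + 0])))
   (Seq (clear (b + 0)) (push_all (b + 0) (bits d))))
  (fun n => 100 * (n + 1) + 2 * bsize d)); first by poly_bounded.
move=> b s a; move: (Hf a); rewrite /bsize /bits; case: (encode a) => [|l r] Ea.
  pose proof (@exec_clear Sigma b s [:: [:: false]] 0 _ erefl) as S1.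
  pose proof (exec_push_all_layout b s [:: [::]] 0 (bits d)) as S2.
  rewrite /= cats0 in S2.
  apply: (@ExecWeaken _ _ _ (4 + 2 * size (bits d)).+1).
    by rewrite Ea; apply: (ExecIfF _ _ (ExecSeq S1 S2)); rewrite on_true_layout.
  by rewrite /= -/(bits d); lia.
pose proof (exec_split_pair b s l r) as S1.
pose proof (@exec_clear Sigma b s [:: preorder r; rev (preorder l)] 0 _ erefl) as S2.
pose proof (@exec_move Sigma b s [:: [::]; rev (preorder l)] 1 0 _ erefl isT) as S3.
rewrite Ea; apply: exec_eq (ExecIfT _ _ (ExecSeq S1 (ExecSeq S2 S3))) _ _.
- by rewrite on_true_layout.
- by apply: eq_layout; do 3?case => //=; rewrite -/(rev _) revK.
- by rewrite /= size_rev size_cat; lia.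
Qed.

(** Covers second projections, tails and predecessors; the leaf case gives [behead [::]] and [0.-1]
    their usual values. *)
Lemma ptime_cdr A B `{Data A} `{Data B} (f : A -> B) :
  (forall a, encode (f a) = if encode a is Node _ r then r else Leaf) ->
  ptime f.
Proof.
move=> Hf.
apply: (@ptime_intro _ _ _ _ _ (fun b => If (b + 0) on_true
   (Seq (split_pair b) (clear (b + 1))) Skip)
  (fun n => 100 * (n + 1))); first by poly_bounded.
move=> b s a; rewrite /bsize /bits Hf; case: (encode a) => [|l r].
  apply: (@ExecWeaken _ _ _ 1) => //.
  by apply: ExecIfF; [rewrite on_true_layout | exact: ExecSkip].
pose proof (exec_split_pair b s l r) as S1.
pose proof (@exec_clear Sigma b s [:: preorder r; rev (preorder l)] 1 _ erefl) as S2.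
apply: exec_eq (ExecIfT _ _ (ExecSeq S1 S2)) _ _.
- by rewrite on_true_layout.
- by apply: eq_layout; do 3?case.
- by rewrite /= size_rev size_cat; lia.
Qed.

Lemma ptime_is_node A `{Data A} (f : A -> bool) :
  (forall a, f a = if encode a is Node _ _ then true else false) -> ptime f.
Proof.
move=> Hf.
apply: (@ptime_intro _ _ _ _ _ (fun b => If (b + 0) on_true
   (Seq (clear (b + 0)) (push_all (b + 0) (bits true)))
   (Seq (clear (b + 0)) (push_all (b + 0) (bits false))))
  (fun n => 100 * (n + 1))); first by poly_bounded.
move=> b s a; rewrite /bsize.
pose proof (@exec_clear Sigma b s [:: bits a] 0 _ erefl) as S1.
pose proof (exec_push_all_layout b s [:: [::]] 0 (bits (f a))) as S2.
rewrite /= cats0 in S2.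
have Ta : on_true (ohead (layout b s [:: bits a] (b + 0))) = f a.
  by rewrite on_true_layout Hf /bits /=; case: (encode a).
pose proof (bsize_bool (f a)) as Sf.
have {}S2 := ExecSeq S1 S2; rewrite /bsize in Sf.
case: (f a) Ta S2 Sf => Ta S2 Sf; (apply: ExecWeaken; first
  by [apply: (ExecIfT _ _ S2); rewrite Ta | apply: (ExecIfF _ _ S2); rewrite Ta]).
  by move: Sf => /=; lia.
by move: Sf => /=; lia.
Qed.

End PolynomialTime.

(** * Loops, logical connectives and folds *)

Section Loops.

Variable Sigma : finType.
Local Notation X := (Sigma + bool)%type.
Local Notation ptime := (@ptime Sigma _ _ _ _).

(** The program never computes [n a]: it tests [t] after each pass, and [n] only counts the passes.
    The bound on every intermediate value has to be assumed, because a polynomial bound on [f] alone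
    does not survive iteration. *)
Lemma ptime_while A `{Data A} (t : A -> bool) (f : A -> A) (n : A -> nat) k :
  ptime t -> ptime f ->
  (forall a, n a <= (bsize a).+2 ^ k) ->
  (forall a j, j < n a -> t (iter j f a)) ->
  (forall a, ~~ t (iter (n a) f a)) ->
  (forall a j, j <= n a -> bsize (iter j f a) <= (bsize a).+2 ^ k) ->
  ptime (fun a => iter (n a) f a).
Proof.
move=> [d [l Ht]] [c [m Hf]] le_n t_lt t_n le_size.
pose test b : cmd X := Seq (copy Sigma b) (d (b + 1)).
pose loop b : cmd X := While (b + 1) on_true
  (Seq (clear (b + 1)) (Seq (c b) (test b))).
pose K M := 100 * (M + 1) + M.+2 ^ l + M.+2 ^ m.
have Htest b (s : store X) a M : bsize a <= M ->
    exec (test b) (layout b s [:: bits a]) (16 * M + 2 + M.+2 ^ l)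
         (layout b s [:: bits a; bits (t a)]).
  move=> le_a.
  pose proof (exec_copy b s (bits a)) as S1.
  pose proof (Ht (b + 1) (layout b s [:: bits a]) a) as S2.
  rewrite -!layout_cons in S2.
  apply: ExecWeaken (ExecSeq S1 S2) _; apply: leq_add.
    by rewrite leq_add2r leq_mul2l.
  by case: (l) => // l'; rewrite leq_exp2r.
have Ton b (s : store X) a : on_true (ohead (layout b s [:: bits a; bits (t a)] (b + 1))) = t a.
  by rewrite on_true_layout /=; case: (t a).
have Hclear b (s : store X) (a : A) (x : bool) :
    exec (clear (b + 1)) (layout b s [:: bits a; bits x]) 10 (layout b s [:: bits a]).
  pose proof (@exec_clear Sigma b s [:: bits a; bits x] 1 _ erefl) as S1.
  apply: exec_eq S1 _ _.
    by apply: eq_layout; do 3?case.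
  by case: x.
(* With one bound [M] for all intermediate values, every pass costs the same [K M], and the
   induction on the number of passes is linear. *)
have Hloop M b (s : store X) N : forall a, (forall j, j < N -> t (iter j f a)) ->
    (forall j, j <= N -> bsize (iter j f a) <= M) -> ~~ t (iter N f a) ->
    exec (loop b) (layout b s [:: bits a; bits (t a)]) (N * K M + 1)
         (layout b s [:: bits (iter N f a); bits (t (iter N f a))]).
  elim: N => [|N IH] a lt_t le_M tN.
    by apply: ExecWeaken; first by apply: ExecWhileF; rewrite Ton.
  have le_a : bsize a <= M by exact: (le_M 0).
  have le_fa : bsize (f a) <= M by exact: (le_M 1).
  apply: (@ExecWeaken _ _ _
    (10 + (M.+2 ^ m + (16 * M + 2 + M.+2 ^ l)) + (N * K M + 1)).+2).
    apply: (ExecWhileT _ _ (s1 := layout b s [:: bits (f a); bits (t (f a))])).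
    - by rewrite Ton; apply: (lt_t 0).
    - apply: ExecSeq (Hclear _ _ _ _) (ExecSeq _ (Htest _ _ _ _ le_fa)).
      apply: ExecWeaken (Hf b s a) _.
      by case: (m) => // m'; rewrite leq_exp2r.
    rewrite iterSr; apply: IH => [j ltj|j lej|]; rewrite -iterSr //.
      exact: lt_t.
    exact: le_M.
  rewrite mulSn /K; set u := _ ^ l; set v := _ ^ m; set w := N * _; lia.
apply: (@ptime_intro _ _ _ _ _ _
  (fun b => Seq (test b) (Seq (loop b) (clear (b + 1))))
  (fun N => (16 * (N.+2 ^ k) + 2 + (N.+2 ^ k).+2 ^ l)
            + ((N.+2 ^ k * K (N.+2 ^ k) + 1) + 10))).
  by rewrite /K; poly_bounded.
move=> b s a; have le_a := le_size a 0 isT.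
apply: ExecSeq (Htest _ _ _ _ le_a) (ExecSeq _ (Hclear _ _ _ _)).
have := Hloop _ b s _ a (t_lt a) (le_size a) (t_n a).
by move=> E1; apply: ExecWeaken E1 _; rewrite leq_add2r leq_mul2r le_n orbT.
Qed.

Section Context.

Variables (T : Type) (dT : Data T).

Lemma ptime_comp2 A B C `{Data A} `{Data B} `{Data C} (g : A -> B -> C) f1 f2 :
  ptime (fun p : A * B => g p.1 p.2) -> ptime f1 -> ptime f2 ->
  ptime (fun x : T => g (f1 x) (f2 x)).
Proof. by move=> Hg Hf Hf'; apply: (ptime_comp Hg (ptime_pair Hf Hf')). Qed.

Lemma ptime_fst A B `{Data A} `{Data B} (f : T -> A * B) :
  ptime f -> ptime (fun x => (f x).1).
Proof. by apply: ptime_comp; apply: (@ptime_car _ _ _ _ _ _ default). Qed.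

Lemma ptime_snd A B `{Data A} `{Data B} (f : T -> A * B) :
  ptime f -> ptime (fun x => (f x).2).
Proof. by apply: ptime_comp; apply: ptime_cdr. Qed.

Lemma ptime_cons A `{Data A} (f : T -> A) g :
  ptime f -> ptime g -> ptime (fun x => f x :: g x).
Proof. by apply: ptime_comp2; apply: ptime_cast. Qed.

Lemma ptime_head A `{Data A} (d : A) f :
  ptime f -> ptime (fun x : T => head d (f x)).
Proof. by apply: ptime_comp; apply: (@ptime_car _ _ _ _ _ _ d); case. Qed.

Lemma ptime_behead A `{Data A} f : ptime f -> ptime (fun x : T => behead (f x : seq A)).
Proof. by apply: ptime_comp; apply: ptime_cdr; case. Qed.

Lemma ptime_nilp A `{Data A} f : ptime f -> ptime (fun x : T => nilp (f x : seq A)).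
Proof.
move=> Hf; apply: (@eq_ptime _ _ _ _ _ (fun x => if ~~ nilp (f x) then false else true)).
  by move=> x; case: nilp.
apply: ptime_if; try exact: ptime_const.
apply: (ptime_comp (g := fun l => ~~ nilp l)) Hf.
by apply: ptime_is_node; case.
Qed.

Lemma ptime_not f : ptime f -> ptime (fun x : T => ~~ f x).
Proof.
move=> Hf; apply: (@eq_ptime _ _ _ _ _ (fun x => if f x then false else true)).
  by move=> x; case: (f x).
by apply: ptime_if Hf _ _; apply: ptime_const.
Qed.

Lemma ptime_and f g : ptime f -> ptime g -> ptime (fun x : T => f x && g x).
Proof. by move=> Hf Hg; apply: ptime_if Hf Hg _; apply: ptime_const. Qed.

Lemma ptime_or f g : ptime f -> ptime g -> ptime (fun x : T => f x || g x).
Proof. by move=> Hf Hg; apply: ptime_if Hf _ Hg; apply: ptime_const. Qed.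

Lemma ptime_implyb f g : ptime f -> ptime g -> ptime (fun x : T => f x ==> g x).
Proof. by move=> Hf Hg; apply: ptime_if Hf Hg _; apply: ptime_const. Qed.

Lemma ptime_eqb (f g : T -> bool) :
  ptime f -> ptime g -> ptime (fun x : T => f x == g x).
Proof.
move=> Hf Hg; apply: (@eq_ptime _ _ _ _ _ (fun x => if f x then g x else ~~ g x)).
  by move=> x; case: (f x); case: (g x).
by apply: ptime_if => //; apply: ptime_not.
Qed.

Lemma bsize_in A `{Data A} (l : seq A) a : List.In a l -> bsize a <= bsize l.
Proof.
elim: l => //= b l IH [->|/IH]; rewrite bsize_cons; lia.
Qed.

Lemma size_le_bsize A `{Data A} (l : seq A) : size l <= bsize l.
Proof. by elim: l => //= a l IH; rewrite bsize_cons; lia. Qed.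

Lemma measure_foldl S A `{Data A} (mu : S -> nat) (F : T -> S -> A -> S) k M c s l :
  (forall c s a, mu (F c s a) <= mu s + (bsize c + bsize a).+2 ^ k) ->
  (forall a, List.In a l -> bsize a <= M) ->
  mu (foldl (F c) s l) <= mu s + size l * (bsize c + M).+2 ^ k.
Proof.
move=> HF; elim: l s => [|a l IH] s Hl /=; first by lia.
apply: leq_trans (IH _ _) _; first by move=> b Hb; apply: Hl; right.
have := HF c s a.
have : (bsize c + bsize a).+2 ^ k <= (bsize c + M).+2 ^ k.
  by case: (k) => // k'; rewrite leq_exp2r // !ltnS leq_add2l; apply: Hl; left.
rewrite mulSn; set u := _ ^ k; set v := _ ^ k; set w := _ * v; lia.
Qed.

End Context.

Section Folds.

Variables (T : Type) (dT : Data T).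

(** Since [true] is longer than [false], lists of bits of known length grow
    additively in [size] but not in [bsize]; hence the measure [mu]. *)
Lemma ptime_foldl_measure S A (dS : Data S) (dA : Data A) (mu : S -> nat) p
    (F : T -> S -> A -> S) s0 l :
  (forall s, mu s <= bsize s <= 4 * mu s + 4) ->
  poly_bounded p ->
  (forall c s a, mu (F c s a) <= mu s + p (bsize c + bsize a)) ->
  ptime (fun q : T * (S * A) => F q.1 q.2.1 q.2.2) -> ptime s0 -> ptime l ->
  ptime (fun c => foldl (F c) (s0 c) (l c)).
Proof.
move=> mu_bsize [k Hk] HF0 pF ps pl.
have HF c s a : mu (F c s a) <= mu s + (bsize c + bsize a).+2 ^ k.
  by apply: leq_trans (HF0 c s a) _; rewrite leq_add2l.
(* The loop state carries the unchanged context, the accumulator and the items still to be read. *)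
pose body (p : T * (S * seq A)) :=
  (p.1, (F p.1 p.2.1 (head (@default A dA) p.2.2), behead p.2.2)).
pose N (p : T * (S * seq A)) := size p.2.2.
have body_iter j c s (l' : seq A) : j <= size l' ->
    iter j body (c, (s, l')) = (c, (foldl (F c) s (take j l'), drop j l')).
  elim: j s l' => [|j IH] s l' le_j; first by rewrite take0 drop0.
  by case: l' le_j => // a l' le_j; rewrite iterSr /= /body /= IH.
have pvar : ptime (fun p : T * (S * seq A) => p) by apply: ptime_id.
have pl' : ptime (fun p : T * (S * seq A) => p.2.2) by do 2!apply: ptime_snd.
have pbody : ptime body.
  apply: ptime_pair; first exact: ptime_fst.
  apply: ptime_pair; last exact: ptime_behead.
  apply: (ptime_comp (g := fun q => F q.1 q.2.1 q.2.2)
    (f := fun p : T * (S * seq A) => (p.1, (p.2.1, head (@default A dA) p.2.2)))) => //.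
  apply: ptime_pair; first exact: ptime_fst.
  apply: ptime_pair; first by apply: ptime_fst; apply: ptime_snd.
  exact: ptime_head.
(* Here [n] is the size of the initial loop state. The term [10 * n] absorbs the context, the
   remaining list and the initial [4 * mu s + 4]; the other term is four times the growth of [mu]
   over at most [n] items. *)
have [K HK] : poly_bounded (fun n => 10 * n + 4 * (n * (n + n).+2 ^ k)) by poly_bounded.
have pw : ptime (fun p => iter (N p) body p).
  apply: (@ptime_while _ _ (fun p => ~~ nilp p.2.2) body N K) => //.
  - by apply: ptime_not; apply: ptime_nilp.
  - move=> [c [s l']]; apply: leq_trans (HK _).
    rewrite /N /= !bsize_pair; pose proof (size_le_bsize l') as le_l; move: le_l.
    by set u := _ * _ ^ k; lia.
  - move=> [c [s l']] j; rewrite /N /= => lt_j; rewrite body_iter ?(ltnW lt_j) //=.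
    by rewrite /nilp size_drop; lia.
  - by move=> [c [s l']]; rewrite /N body_iter //= drop_size.
  move=> [c [s l']] j; rewrite /N /= => le_j; rewrite body_iter //.
  apply: leq_trans (HK _); rewrite !bsize_pair.
  have drop_le : bsize (drop j l') <= bsize l'.
    elim: (j) (l') => [|j' IHj] [|a l''] //=; rewrite bsize_cons.
    by have := IHj l''; lia.
  have : mu (foldl (F c) s (take j l')) <=
         mu s + size (take j l') * (bsize c + bsize l').+2 ^ k.
    apply: measure_foldl HF _ => a a_in; apply: bsize_in.
    elim: (j) (l') a_in => [|j' IHj] [|a' l''] //= [->|/IHj]; by [left|right].
  have : size (take j l') * (bsize c + bsize l').+2 ^ k <=
         (bsize c + (bsize s + bsize l').+1).+1 *
         ((bsize c + (bsize s + bsize l').+1).+1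
          + (bsize c + (bsize s + bsize l').+1).+1).+2 ^ k.
    apply: leq_mul.
      by rewrite size_take_min; pose proof (size_le_bsize l'); lia.
    by case: (k) => // k'; rewrite leq_exp2r //; lia.
  have := mu_bsize s; have := mu_bsize (foldl (F c) s (take j l')).
  by set u := _ * _ ^ k; set v := _ * _ ^ k; lia.
apply: (@eq_ptime _ _ _ _ _ (fun c => (iter (N (c, (s0 c, l c))) body (c, (s0 c, l c))).2.1)).
  by move=> c; rewrite body_iter //= take_size.
apply: ptime_fst; apply: ptime_snd.
apply: (ptime_comp (f := fun c => (c, (s0 c, l c)))) pw _.
by apply: ptime_pair; [exact: ptime_id | exact: ptime_pair].
Qed.

Lemma ptime_foldl S A (dS : Data S) (dA : Data A) p (F : T -> S -> A -> S) s0 l :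
  poly_bounded p ->
  (forall c s a, bsize (F c s a) <= bsize s + p (bsize c + bsize a)) ->
  ptime (fun q : T * (S * A) => F q.1 q.2.1 q.2.2) -> ptime s0 -> ptime l ->
  ptime (fun c => foldl (F c) (s0 c) (l c)).
Proof.
move=> Hp HF; apply: ptime_foldl_measure Hp HF => s.
by rewrite leqnn /=; lia.
Qed.

End Folds.

End Loops.

(** An extension point, tried before the rules for projections and connectives; it is redefined once
    comparison and lookup of payoffs have been treated. *)
Ltac ptime_hook := fail.

Ltac ptime := repeat lazymatch goal with |- @ptime _ _ _ _ _ _ => first
  [ assumption | exact: ptime_id | exact: ptime_const
  | lazymatch goal with |- @ptime _ _ _ _ _ (fun x => (@?a x, @?b x)) => apply: ptime_pair end
  | ptime_hook
  | apply: ptime_fst | apply: ptime_snd | apply: ptime_cons | apply: ptime_behead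
  | apply: ptime_head | apply: ptime_nilp | apply: ptime_not | apply: ptime_and
  | apply: ptime_or | apply: ptime_implyb | apply: ptime_eqb | apply: ptime_if ] end.

(** * List operations and unary arithmetic *)

Section Lists.

Variables (Sigma : finType) (T : Type) (dT : Data T).
Local Notation ptime := (@ptime Sigma _ _ _ _).

Lemma ptime_rev A (dA : Data A) (l : T -> seq A) :
  ptime l -> ptime (fun x => rev (l x)).
Proof.
move=> pl; apply: (@eq_ptime _ _ _ _ _ (fun x => foldl (fun s a => a :: s) [::] (l x))).
  by move=> x; rewrite /rev; elim: (l x) [::] => //=.
apply: (@ptime_foldl _ _ _ _ _ _ _ succn (fun _ s a => a :: s)) => //; ptime.
- by poly_bounded.
- by move=> c s a; rewrite bsize_cons; lia.
Qed.

Lemma ptime_foldr S A (dS : Data S) (dA : Data A) p (F : T -> A -> S -> S) z l :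
  poly_bounded p ->
  (forall c a s, bsize (F c a s) <= bsize s + p (bsize c + bsize a)) ->
  ptime (fun q : T * (S * A) => F q.1 q.2.2 q.2.1) -> ptime z -> ptime l ->
  ptime (fun c => foldr (F c) (z c) (l c)).
Proof.
move=> Hp HF pF pz pl.
apply: (@eq_ptime _ _ _ _ _ (fun c => foldl (fun s a => F c a s) (z c) (rev (l c)))).
  by move=> c; rewrite foldl_rev.
by apply: ptime_foldl Hp _ pF pz (ptime_rev pl) => c s a; apply: HF.
Qed.

Lemma ptime_map A B (dA : Data A) (dB : Data B) (f : T -> A -> B) l :
  ptime (fun q : T * A => f q.1 q.2) -> ptime l ->
  ptime (fun c => [seq f c a | a <- l c]).
Proof.
move=> pf pl; have [k Hk] := ptime_size pf.
have [p Hp] : exists2 p, poly_bounded p &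
    forall c a, bsize (f c a) <= p (bsize c + bsize a).
  exists (fun n => n.+1.+2 ^ k); first by poly_bounded.
  by move=> c a; have := Hk (c, a); rewrite bsize_pair.
move=> f_le; apply: (@eq_ptime _ _ _ _ _ (fun c => foldr (fun a s => f c a :: s) [::] (l c))).
  by move=> c; elim: (l c) => //= a s ->.
apply: (@ptime_foldr _ _ _ _ (fun n => (p n).+1)) => //; last by ptime.
- by poly_bounded.
- by move=> c a s; rewrite bsize_cons; have := f_le c a; lia.
- apply: ptime_cons; last by ptime.
  by apply: (ptime_comp (f := fun q : T * (seq B * A) => (q.1, q.2.2))) pf _; ptime.
Qed.

Lemma ptime_cat A (dA : Data A) (l l' : T -> seq A) :
  ptime l -> ptime l' -> ptime (fun x => l x ++ l' x).
Proof.
move=> pl pl'; apply: (@eq_ptime _ _ _ _ _ (fun x => foldr cons (l' x) (l x))).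
  by move=> x; elim: (l x) => //= a s ->.
apply: (@ptime_foldr _ _ _ _ succn (fun _ => cons)) => //; ptime.
- by poly_bounded.
- by move=> c s a; rewrite bsize_cons; lia.
Qed.

Lemma ptime_rcons A (dA : Data A) (l : T -> seq A) a :
  ptime l -> ptime a -> ptime (fun x => rcons (l x) (a x)).
Proof.
move=> pl pa; apply: (@eq_ptime _ _ _ _ _ (fun x => l x ++ [:: a x])).
  by move=> x; rewrite cats1.
by apply: ptime_cat => //; ptime.
Qed.

Lemma bsize_cat A `{Data A} (l l' : seq A) : bsize (l ++ l') <= bsize l + bsize l'.
Proof. by elim: l => [|a l IH] /=; rewrite ?bsize_cons; lia. Qed.

Lemma ptime_has A (dA : Data A) (a : T -> A -> bool) l :
  ptime (fun q : T * A => a q.1 q.2) -> ptime l ->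
  ptime (fun c => has (a c) (l c)).
Proof.
move=> pa pl; apply: (@eq_ptime _ _ _ _ _
    (fun c => foldr (fun x b => a c x || b) false (l c))).
  by move=> c; elim: (l c) => //= x s ->.
apply: (@ptime_foldr _ _ _ _ (fun=> 3)) => //; last by ptime.
- by poly_bounded.
- by move=> c x b; have := bsize_bool (a c x || b); lia.
- apply: ptime_or; last by ptime.
  by apply: (ptime_comp (f := fun q : T * (bool * A) => (q.1, q.2.2))) pa _; ptime.
Qed.

Lemma ptime_all A (dA : Data A) (a : T -> A -> bool) l :
  ptime (fun q : T * A => a q.1 q.2) -> ptime l ->
  ptime (fun c => all (a c) (l c)).
Proof.
move=> pa pl; apply: (@eq_ptime _ _ _ _ _ (fun c => ~~ has (fun x => ~~ a c x) (l c))).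
  by move=> c; rewrite -all_predC; apply: eq_all => x /=; rewrite negbK.
by apply/ptime_not/ptime_has => //; apply: ptime_not.
Qed.

Lemma bsize_nat n : bsize n = n.*2.+1.
Proof. by elim: n => // n IH; rewrite doubleS -IH. Qed.

Lemma ptime_nseq n : ptime n -> ptime (fun x : T => nseq (n x) false).
Proof. by apply: ptime_comp; apply: ptime_cast; elim=> //= n' ->. Qed.

Lemma ptime_ticks n : ptime n -> ptime (fun x : T => nseq (n x) tt).
Proof. by apply: ptime_comp; apply: ptime_cast; elim=> //= n' ->. Qed.

Lemma ptime_succ n : ptime n -> ptime (fun x : T => (n x).+1).
Proof.
move=> pn; apply: (@eq_ptime _ _ _ _ _ (fun x => size (tt :: nseq (n x) tt))).
  by move=> x /=; rewrite size_nseq.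
apply: (ptime_comp (g := @size unit)).
  by apply: ptime_cast; elim=> //= -[] l ->.
by apply: ptime_cons; [ptime | apply: ptime_ticks].
Qed.

Lemma ptime_pred n : ptime n -> ptime (fun x : T => (n x).-1).
Proof. by apply: ptime_comp; apply: ptime_cdr; case. Qed.

Lemma ptime_eq0 n : ptime n -> ptime (fun x : T => n x == 0).
Proof.
move=> pn; apply: (@eq_ptime _ _ _ _ _ (fun x => nilp (nseq (n x) tt))).
  by move=> x; rewrite /nilp size_nseq.
by apply/ptime_nilp/ptime_ticks.
Qed.

End Lists.

Section Arithmetic.

Variables (Sigma : finType) (T : Type) (dT : Data T).
Local Notation ptime := (@ptime Sigma _ _ _ _).

Lemma ptime_flatten A (dA : Data A) (l : T -> seq (seq A)) :
  ptime l -> ptime (fun x => flatten (l x)).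
Proof.
move=> pl; apply: (@ptime_foldr _ _ _ _ _ _ _ id (fun _ => cat)) => //; last by ptime.
- by poly_bounded.
- by move=> c a s; pose proof (bsize_cat a s); lia.
- by apply: ptime_cat; ptime.
Qed.

Lemma ptime_size_seq A (dA : Data A) (l : T -> seq A) :
  ptime l -> ptime (fun x => size (l x)).
Proof.
move=> pl; apply: (@eq_ptime _ _ _ _ _ (fun x => foldr (fun _ n => n.+1) 0 (l x))) => //.
apply: (@ptime_foldr _ _ _ _ _ _ _ (fun=> 2) (fun _ _ n => n.+1)) => //; last by ptime.
- by poly_bounded.
- by move=> _ _ n; rewrite !bsize_nat; lia.
- by apply: ptime_succ; ptime.
Qed.

Lemma ptime_sub n m : ptime n -> ptime m -> ptime (fun x : T => n x - m x).
Proof.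
move=> pn pm; apply: (@eq_ptime _ _ _ _ _
    (fun x => foldl (fun s _ => s.-1) (n x) (nseq (m x) tt))).
  by move=> x; elim: (m x) (n x) => [|k IH] i /=; rewrite ?IH; lia.
apply: (@ptime_foldl _ _ _ _ _ _ _ (fun=> 0) (fun _ s _ => s.-1)) => //.
- by poly_bounded.
- by move=> _ s _; rewrite !bsize_nat; lia.
- by apply: ptime_pred; ptime.
- exact: ptime_ticks.
Qed.

Lemma ptime_add n m : ptime n -> ptime m -> ptime (fun x : T => n x + m x).
Proof.
move=> pn pm; apply: (@eq_ptime _ _ _ _ _
    (fun x => foldl (fun s _ => s.+1) (n x) (nseq (m x) tt))).
  by move=> x; elim: (m x) (n x) => [|k IH] i /=; rewrite ?IH; lia.
apply: (@ptime_foldl _ _ _ _ _ _ _ (fun=> 2) (fun _ s _ => s.+1)) => //.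
- by poly_bounded.
- by move=> _ s _; rewrite !bsize_nat; lia.
- by apply: ptime_succ; ptime.
- exact: ptime_ticks.
Qed.

Lemma ptime_leq n m : ptime n -> ptime m -> ptime (fun x : T => n x <= m x).
Proof. by move=> pn pm; apply/ptime_eq0/ptime_sub. Qed.

Lemma ptime_eqn n m : ptime n -> ptime m -> ptime (fun x : T => n x == m x).
Proof.
move=> pn pm; apply: (@eq_ptime _ _ _ _ _ (fun x => (n x <= m x) && (m x <= n x))).
  by move=> x; rewrite eqn_leq.
by apply: ptime_and; apply: ptime_leq.
Qed.

Lemma ptime_nth A (dA : Data A) d (l : T -> seq A) i :
  ptime l -> ptime i -> ptime (fun x => nth d (l x) (i x)).
Proof.
move=> pl pi; apply: (@eq_ptime _ _ _ _ _
    (fun x => head d (foldl (fun s _ => behead s) (l x) (nseq (i x) tt)))).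
  by move=> x; elim: (i x) (l x) => [|k IH] [|a s] //=; rewrite IH ?nth_nil.
apply: ptime_head; apply: (@ptime_foldl _ _ _ _ _ _ _ (fun=> 0) (fun _ s _ => behead s)) => //.
- by poly_bounded.
- by move=> _ [|a s] _; rewrite ?bsize_cons /=; lia.
- by ptime.
- exact: ptime_ticks.
Qed.

End Arithmetic.

(** The list is built from its largest element downwards, and the next number is recovered from the
    length of the part already built. A new item is at most the size of [n x], which is polynomial
    in the context. *)
Lemma ptime_iota Sigma T (dT : Data T) n :
  @ptime Sigma _ _ _ _ n -> @ptime Sigma _ _ _ _ (fun x : T => iota 0 (n x)).
Proof.
move=> pn; apply: (@eq_ptime _ _ _ _ _
    (fun x => foldl (fun s _ => (n x - size s).-1 :: s) [::] (nseq (n x) tt))).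
  move=> x; have: forall k m, k + m = n x ->
      foldl (fun s _ => (n x - size s).-1 :: s) (iota k m) (nseq k tt) = iota 0 (n x).
    elim=> [|k IH] m; first by rewrite add0n => <-.
    move=> E; rewrite -(IH m.+1); last by lia.
    by rewrite /= size_iota; congr (foldl _ (_ :: _) _); lia.
  by move=> /(_ (n x) 0); rewrite addn0; apply.
have [k Hk] := ptime_size pn.
apply: (@ptime_foldl _ _ _ _ _ _ _ (fun m => (m.+2 ^ k).+2)
   (fun x s _ => (n x - size s).-1 :: s)) => //.
- by poly_bounded.
- move=> x s u; rewrite bsize_cons bsize_nat; have := Hk x; rewrite bsize_nat.
  have : (bsize x).+2 ^ k <= (bsize x + bsize u).+2 ^ k.
    by case: (k) => // k'; rewrite leq_exp2r // !ltnS leq_addr.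
  by set u1 := _ ^ k; set u2 := _ ^ k; lia.
- apply: ptime_cons; last by ptime.
  apply: ptime_pred; apply: ptime_sub; last by apply: ptime_size_seq; ptime.
  by apply: (ptime_comp (g := n)) => //; ptime.
- by ptime.
- exact: ptime_ticks.
Qed.

Ltac ptime_nat := repeat lazymatch goal with |- @ptime _ _ _ _ _ _ => first
  [ progress ptime | apply: ptime_nseq | apply: ptime_succ | apply: ptime_pred
  | apply: ptime_size_seq | apply: ptime_sub | apply: ptime_add | apply: ptime_leq
  | apply: ptime_eqn | apply: ptime_nth | apply: ptime_iota | apply: ptime_rev
  | apply: ptime_cat | apply: ptime_rcons | apply: ptime_flatten
  | apply: ptime_map | apply: ptime_has | apply: ptime_all ] end.

Lemma ptime_eq_seq (Sigma : finType) T (dT : Data T) (A : eqType) (dA : Data A)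
    (l l' : T -> seq A) :
  ptime Sigma (fun p : A * A => p.1 == p.2) ->
  ptime Sigma l -> ptime Sigma l' -> ptime Sigma (fun x => l x == l' x).
Proof.
move=> peq pl pl'; apply: (@eq_ptime _ _ _ _ _ (fun x =>
    (size (l x) == size (l' x)) &&
    all (fun i => nth default (l x) i == nth default (l' x) i) (iota 0 (size (l x))))).
  move=> x; apply/andP/eqP => [[/eqP Es /allP E]|->].
    apply: (@eq_from_nth _ default) => // i lti; apply/eqP/E.
    by rewrite mem_iota.
  by rewrite eqxx; split => //; apply/allP => i _.
ptime_nat.
apply: (ptime_comp (f := fun q : T * nat =>
   (nth default (l q.1) q.2, nth default (l' q.1) q.2))) peq _.
ptime_nat.
- by apply: (ptime_comp (g := l)) => //; ptime.
- by apply: (ptime_comp (g := l')) => //; ptime.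
Qed.

(** * Reading the input *)

Section Input.

Variables (Sigma : finType) (dS : Data Sigma).
Local Notation X := (Sigma + bool)%type.

Definition input_store (w : seq Sigma) (v : seq bool) : store X :=
  fun i => if i == 0 then [seq inl a | a <- w]
           else if i == 1 then [seq inr x | x <- v] else [::].

Definition load_symbol (s : seq Sigma) : cmd X :=
  foldr (fun a c => If 0 (pred1 (Some (inl a)))
    (Seq (Pop 0) (push_all 1 (rev (true :: bits a)))) c) Skip s.

Lemma exec_load_symbol s a w v :
  a \in s ->
  exec (load_symbol s) (input_store (a :: w) v)
    (size s + 2 * bsize a + 5) (input_store w (catrev (true :: bits a) v)).
Proof.
have H1 b : exec (Seq (Pop 0) (push_all 1 (rev (true :: bits b))))
   (input_store (b :: w) v) (1 + 2 * (bsize b).+1)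
   (input_store w (catrev (true :: bits b) v)).
  apply: exec_eq (ExecSeq (ExecPop _ _) (exec_push_all _ _ _)) _ _.
    apply: funext => i; rewrite /upd /input_store catrevE map_cat.
    by case: eqP => [->|] //; case: eqP.
  by rewrite size_rev /bsize /=; lia.
elim: s => //= b s IH; rewrite inE; case: (eqVneq a b) => [-> _|ne_ab /= /IH H2].
  apply: (@ExecWeaken _ _ _ (1 + 2 * (bsize b).+1).+2); last by lia.
  by apply: (ExecIfT _ _ (H1 b)); rewrite /= eqxx.
apply: (@ExecWeaken _ _ _ (size s + 2 * @bsize Sigma dS a + 5).+1); last by lia.
apply: (ExecIfF _ _ H2); rewrite /=.
by apply: contra_neqN ne_ab => /eqP[].
Qed.

(** Stack 1 collects, in reverse, a [true] and the code of each input symbol. The last [false] is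
    the leaf that ends a list, and the final move restores the order on stack 0. *)
Definition load : cmd X :=
  Seq (While 0 on_some (load_symbol (enum Sigma)))
      (Seq (Push (0 + 1) (inr false)) (move_to (0 + 1) [:: 0 + 0])).

Lemma exec_load : exists C, forall w,
  exec load (input_store w [::]) (C * (size w + 1))
       (layout 0 (fun=> [::]) [:: bits w]).
Proof.
(* [C] bounds the cost of one symbol: up to [#|Sigma|] tests, two steps per bit of its code, 5 more
   for popping and for the extra [true], and 2 for the loop. *)
pose B := \max_(a : Sigma) @bsize Sigma dS a; pose C := #|Sigma| + 2 * B + 7.
have HW (w : seq Sigma) v : exec (While 0 on_some (load_symbol (enum Sigma)))
    (input_store w v) (C * size w + 1)
    (input_store [::] (catrev (flatten [seq true :: bits a | a <- w]) v)).
  elim: w v => [|a w IH] v.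
    by apply: (@ExecWeaken _ _ _ 1); [exact: ExecWhileF | lia].
  apply: (@ExecWeaken _ _ _ (size (enum Sigma) + 2 * bsize a + 5 + (C * size w + 1)).+2).
    apply: (ExecWhileT _ (exec_load_symbol w v (mem_enum _ a))) => //.
    by have := IH (catrev (true :: @bits Sigma dS a) v); rewrite -catrev_catl.
  have : @bsize Sigma dS a <= B by apply: (leq_bigmax a).
  rewrite -cardE /= mulnS {2}/C; move: (bsize a) (C * size w) #|_| => x y z; lia.
have bitsE (w : seq Sigma) : bits w = flatten [seq true :: bits a | a <- w] ++ [:: false].
  elim: w => // a w IH; have -> : bits (a :: w) = true :: @bits Sigma dS a ++ bits w by [].
  by rewrite IH /= -!catA.
have input_layout v : input_store [::] v = layout 0 (fun=> [::]) [:: [::]; v].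
  apply: funext => i; rewrite /input_store /layout /= subn0.
  by case: i => [|[|i]] //=; rewrite nth_nil.
exists (100 * C + 100) => w.
set u := flatten [seq true :: @bits Sigma dS a | a <- w].
have Su : size u <= (B + 1) * size w.
  rewrite /u; elim: (w) => //= a w' IH; rewrite size_cat.
  have : @bsize Sigma dS a <= B by apply: (leq_bigmax a).
  by rewrite /bsize mulnS; set y := _ * size w'; lia.
have H1 := HW w [::]; rewrite -/u -/(rev u) input_layout in H1.
have H2 := exec_push 0 (fun=> [::]) [:: [::]; rev u] 1 (false) : exec (_ : cmd X) _ _ _.
have H3 := @exec_move Sigma 0 (fun=> [::]) [:: [::]; false :: rev u] 1 0 _ erefl isT.
apply: exec_eq (ExecSeq H1 (ExecSeq H2 H3)) _ _.
  have Eu : catrev (false :: rev u) [::] = bits w.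
    by rewrite bitsE -/u -/(rev _) rev_cons revK cats1.
  by apply: eq_layout; do 3?case => //=.
have Cw : 2 * (B * size w) + 7 * size w <= C * size w.
  by rewrite /C !mulnDl; move: (B * _) (#|_| * _) => y z; lia.
rewrite /= size_rev mulnDr muln1 mulnDl -mulnA.
by move: Su Cw; rewrite mulnDl mul1n; move: (B * _) (C * _) => y z; lia.
Qed.

End Input.

Lemma poly_bounded_in_P p : poly_bounded p -> exists k, forall n, p n <= n ^ k + k.
Proof.
(* For [n >= 2] one has [n + 2 <= n ^ 2], so the exponent [2 * K] suffices; for [n] equal to 0 or 1
   the additive constant [3 ^ K] takes over. *)
move=> [K HK]; exists (3 ^ K + 2 * K) => n; apply: leq_trans (HK n) _.
have le23 : 2 ^ K <= 3 ^ K by case: K {HK} => // K; rewrite leq_exp2r.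
case: n => [|[|n]]; first by lia.
  by rewrite exp1n; lia.
apply: (@leq_trans (n.+2 ^ (2 * K))).
  by rewrite expnM; case: K {HK le23} => // K; rewrite leq_exp2r //; lia.
by apply: leq_trans (leq_addr _ _); rewrite leq_exp2l //; lia.
Qed.

(** The code of a boolean begins with that boolean, which is exactly the bit that the machine
    inspects at the end. *)
Lemma ptime_in_P (Sigma : finType) (dS : Data Sigma) (f : seq Sigma -> bool) :
  ptime Sigma f -> in_P (fun w => f w).
Proof.
move=> [c [k Hf]]; have [C HC] := exec_load dS.
have [M HM] := exec_verdict (Seq (load dS) (c 0)).
pose B := \max_(a : Sigma) @bsize Sigma dS a.
have bsize_w (w : seq Sigma) : bsize w <= (B + 1) * size w + 1.
  elim: w => [|a w IH]; first by rewrite (@bsize_nil Sigma) muln0.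
  have : @bsize Sigma dS a <= B by apply: (leq_bigmax a).
  by rewrite bsize_cons mulnS; move: IH; set y := _ * size w; lia.
have [K HK] : exists k', forall n,
    (C * (n + 1) + ((B + 1) * n + 1).+2 ^ k).+1 <= n ^ k' + k'.
  by apply: poly_bounded_in_P; poly_bounded.
exists M, K => w; exists (f w); split => //.
apply: iter_verdict (HK _).
rewrite (HM _ _ (layout 0 (fun=> [::]) [:: bits (f w)])).
  by rewrite /layout /=; case: (f w).
have -> : (fun i => if i == 0 then [seq inl x | x <- w] else [::]) =
          input_store w [::] :> store _.
  by apply: funext => i; rewrite /input_store; case: eqP => //; case: eqP.
apply: ExecSeq (HC w) _; apply: ExecWeaken (Hf _ _ _) _.
by case: (k) => // k'; rewrite leq_exp2r // !ltnS; apply: bsize_w.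
Qed.

(** * The decision procedure *)

(** Least significant bit first, unlike [binary_value]. *)
Definition bit_value (s : seq bool) : nat := foldr (fun (b : bool) n => b + n.*2) 0 s.

(** A ripple-carry adder: the sum bit is an exclusive or, the new carry a majority. The recursion
    follows [xs] and reads zeros past the end of [ys], so the value is right when [xs] is at least
    as long; padding ensures this in [add_bits]. *)
Fixpoint add_carry (xs ys : seq bool) (c : bool) : seq bool :=
  if xs is x :: xs' then
    (x != (head false ys != c)) ::
    add_carry xs' (behead ys)
      (if x then head false ys || c else head false ys && c)
  else [:: c].

Definition add_bits xs ys := add_carry (xs ++ nseq (size ys) false) ys false.

(** The second factor has its most significant bit first. *)
Definition mul_bits xs ys :=
  foldl (fun acc (b : bool) => add_bits (false :: acc) (if b then xs else [::]))
    [::] ys.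

(** [r] is the outcome on the less significant bits already read; a later pair of different bits
    overrides it. *)
Fixpoint leq_from (xs ys : seq bool) (r : bool) : bool :=
  if xs is x :: xs' then
    leq_from xs' (behead ys) (if x == head false ys then r else head false ys)
  else r.

Definition leq_bits xs ys := leq_from (xs ++ nseq (size ys) false) ys true.

Lemma bit_value_head s : bit_value s = head false s + (bit_value (behead s)).*2.
Proof. by case: s. Qed.

Lemma bit_value_pad s n : bit_value (s ++ nseq n false) = bit_value s.
Proof. by elim: s => [|b s /= ->] //=; elim: n => //= n ->. Qed.

Lemma add_carry_value xs ys c :
  size ys <= size xs ->
  bit_value (add_carry xs ys c) = bit_value xs + bit_value ys + c.
Proof.
elim: xs ys c => [|x xs IH] ys c /=; first by case: ys => //; case: c.
move=> le_s; rewrite IH ?size_behead; last by lia.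
rewrite (bit_value_head ys).
by case: x; case: (head _ _); case: c => /=; lia.
Qed.

Lemma size_add_carry xs ys c : size (add_carry xs ys c) = (size xs).+1.
Proof. by elim: xs ys c => //= x xs IH ys c; rewrite IH. Qed.

Lemma add_bits_value xs ys :
  bit_value (add_bits xs ys) = bit_value xs + bit_value ys.
Proof.
by rewrite /add_bits add_carry_value ?bit_value_pad ?addn0 // size_cat size_nseq leq_addl.
Qed.

Lemma mul_bits_value xs ys :
  bit_value (mul_bits xs ys) = bit_value xs * binary_value ys.
Proof.
rewrite /mul_bits /binary_value.
suff gen acc n : bit_value acc = bit_value xs * n ->
    bit_value (foldl (fun acc (b : bool) =>
      add_bits (false :: acc) (if b then xs else [::])) acc ys) =
    bit_value xs * foldl (fun (acc : nat) (b : bool) => acc.*2 + b) n ys.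
  by apply: gen; rewrite muln0.
elim: ys acc n => [|b ys IH] acc n //= E; apply: IH.
by rewrite add_bits_value /= E; case: b => /=; lia.
Qed.

(** If [r] is [false], the lower part of the first number was larger, and the remaining bits must
    compare strictly; this is the summand [~~ r]. *)
Lemma leq_from_value xs ys r :
  size ys <= size xs ->
  leq_from xs ys r = (bit_value xs + ~~ r <= bit_value ys).
Proof.
elim: xs ys r => [|x xs IH] ys r /=; first by case: ys => //; case: r.
move=> le_s; rewrite IH ?size_behead; last by lia.
rewrite (bit_value_head ys).
by case: x; case: (head _ _); case: r => /=; lia.
Qed.

Lemma leq_bits_value xs ys : leq_bits xs ys = (bit_value xs <= bit_value ys).
Proof.
by rewrite /leq_bits leq_from_value ?bit_value_pad ?addn0 // size_cat size_nseq leq_addl.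
Qed.

Lemma bit_value_rev s : bit_value (rev s) = binary_value s.
Proof.
rewrite -[in RHS](revK s) /binary_value foldl_rev.
by elim: (rev s) => //= b t ->; rewrite addnC.
Qed.

Lemma bit_value_eq0 s : (bit_value s == 0) = ~~ has id s.
Proof. by elim: s => //= -[] s IH; rewrite ?addn_eq0 //= double_eq0. Qed.

(** Nested pairs instead of the record, so that the tree encoding comes from the instances for
    products and lists. *)
Definition literal : Type := bool * (seq bool * seq bool).

(** [x] and [y] are the absolute values after multiplication by both denominators. A nonnegative
    literal is below one with a minus sign only if both are zero, as [-0] is a legal literal. *)
Definition literal_le (a b : literal) : bool :=
  let x := mul_bits (rev a.2.1) b.2.2 in
  let y := mul_bits (rev b.2.1) a.2.2 in
  if a.1 then (if b.1 then leq_bits y x else true)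
  else if b.1 then ~~ has id x && ~~ has id y else leq_bits x y.

Definition entry (M : seq (seq literal)) i j : literal :=
  nth (false, ([::], [::])) (nth [::] M i) j.

Section Round.

Variables (n m : nat) (A B : seq (seq literal)) (I J : seq bool).

Definition row_dominatedb k :=
  has (fun i => nth false I i && has (fun j0 => nth false J j0 &&
    (all (fun j => nth false J j ==> literal_le (entry A k j) (entry A i j))
       (iota 0 m) &&
     ~~ literal_le (entry A i j0) (entry A k j0))) (iota 0 m)) (iota 0 n).

Definition col_dominatedb l :=
  has (fun j => nth false J j && has (fun i0 => nth false I i0 &&
    (all (fun i => nth false I i ==> literal_le (entry B i l) (entry B i j))
       (iota 0 n) &&
     ~~ literal_le (entry B i0 j) (entry B i0 l))) (iota 0 n)) (iota 0 m).

Definition elimination_round : seq bool * seq bool :=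
  ([seq nth false I k && ~~ row_dominatedb k | k <- iota 0 n],
   [seq nth false J l && ~~ col_dominatedb l | l <- iota 0 m]).

End Round.

Definition elimination n m A B :=
  foldl (fun S (_ : nat) => elimination_round n m A B S.1 S.2)
    ([seq true | _ <- iota 0 n], [seq true | _ <- iota 0 m]) (iota 0 (n + m)).

(** [sep] terminates pieces rather than separating them: an empty rest after the
    last [sep] is not a piece. *)
Definition pieces (sep : symbol) (w : seq symbol) : seq (seq symbol) :=
  foldr (fun a s => if a == sep then [::] :: s
                    else (a :: head [::] s) :: behead s) [::] w.

Definition parse_literal (e : seq symbol) : literal :=
  (head Zero e == Minus,
   ([seq x == One | x <- nth [::]
       (pieces Slash (if head Zero e == Minus then behead e else e)) 0],
    [seq x == One | x <- nth [::]
       (pieces Slash (if head Zero e == Minus then behead e else e)) 1])).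

Definition parse_matrix (w : seq symbol) : seq (seq literal) :=
  [seq [seq parse_literal e | e <- pieces Comma r] | r <- pieces Semicolon w].

Definition instance : Type := nat * (seq (seq literal) * seq (seq literal)).

Definition parse_instance (w : seq symbol) : instance :=
  (size (nth [::] (pieces Hash w) 0),
   (parse_matrix (nth [::] (pieces Hash w) 1),
    parse_matrix (nth [::] (pieces Hash w) 2))).

Definition unparse_literal (e : literal) : seq symbol :=
  (if e.1 then [:: Minus] else [::]) ++
  encode_numeral e.2.1 ++ Slash :: encode_numeral e.2.2.

Definition unparse_matrix (M : seq (seq literal)) : seq symbol :=
  flatten [seq rcons (flatten [seq rcons (unparse_literal e) Comma | e <- r])
                 Semicolon | r <- M].

Definition unparse_instance (g : instance) : seq symbol :=
  [seq One | _ <- iota 0 g.1] ++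
  Hash :: unparse_matrix g.2.1 ++ Hash :: unparse_matrix g.2.2.

(** The index condition forces at least one row, so [head] yields a genuine row to which all lengths
    are compared. A denominator is nonzero when some bit is set. *)
Definition valid (w : seq symbol) (g : instance) : bool :=
  [&& w == unparse_instance g, 0 < g.1, g.1 <= size g.2.1, size g.2.2 == size g.2.1,
      all (fun r => size r == size (head [::] g.2.1)) (g.2.1 ++ g.2.2) &
      all (fun r => all (fun e : literal => has id e.2.2) r) (g.2.1 ++ g.2.2)].

Definition eliminatedb (g : instance) : bool :=
  ~~ nth false (elimination (size g.2.1) (size (head [::] g.2.1)) g.2.1 g.2.2).1
       g.1.-1.

Definition decide (w : seq symbol) : bool :=
  valid w (parse_instance w) && eliminatedb (parse_instance w).

#[export] Instance data_symbol : Data symbol :=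
  {| encode s := encode (nat_of_ord (symbol_code s)); default := Zero |}.

(** * Running time of the decision procedure *)

Section ComparisonTime.

Variable Sigma : finType.
Local Notation ptime := (@ptime Sigma _ _ _ _).

Lemma bsize_bits (s : seq bool) : size s <= bsize s <= 4 * size s + 4.
Proof.
elim: s => // b s IH; rewrite bsize_cons /=; have := bsize_bool b.
by have := bsize_gt0 b; lia.
Qed.

(** Addition as a left fold over the padded first summand. The state holds the rest of the second
    summand, the carry and the reversed output; the last carry becomes the top bit. *)
Lemma ptime_add_bits T (dT : Data T) (f g : T -> seq bool) :
  ptime f -> ptime g -> ptime (fun x => add_bits (f x) (g x)).
Proof.
move=> pf pg.
pose F (_ : T) (s : (seq bool * bool) * seq bool) (x : bool) :=
  ((behead s.1.1, if x then head false s.1.1 || s.1.2 else head false s.1.1 && s.1.2),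
   (x != (head false s.1.1 != s.1.2)) :: s.2).
pose F' x := foldl (F x) ((g x, false), [::]) (f x ++ nseq (size (g x)) false).
apply: (@eq_ptime _ _ _ _ _ (fun x => rev ((F' x).1.2 :: (F' x).2))).
  move=> x; rewrite /F' /add_bits; move: (_ ++ _) => xs.
  rewrite -[RHS]/(rev [::] ++ add_carry xs (g x) false).
  elim: xs [::] (g x) false => [|y xs IH] out ys c /=; first by rewrite rev_cons cats1.
  by rewrite IH /= rev_cons cat_rcons.
have pF : ptime F'.
  apply: (@ptime_foldl _ _ _ _ _ _ _ (fun=> 20)) => //.
  - by poly_bounded.
  - move=> t0 [[ys c] out] x; rewrite /F /= !bsize_pair bsize_cons.
    set u := (if _ then _ else _); set v := _ != _.
    have := bsize_bool u; have := bsize_bool v.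
    move: (bsize u) (bsize v) => nu nv {u v}.
    by case: ys => [|y ys] /=; rewrite ?bsize_cons; lia.
  - by rewrite /F; ptime.
  - by ptime.
  - by ptime_nat.
by ptime_nat.
Qed.

(** An addition may flip many bits of the accumulator, but its number of bits grows by at most
    [size (f x) + 2]; hence the measure [size] here. *)
Lemma ptime_mul_bits T (dT : Data T) (f g : T -> seq bool) :
  ptime f -> ptime g -> ptime (fun x => mul_bits (f x) (g x)).
Proof.
move=> pf pg; have [k Hk] := ptime_size pf.
apply: (@ptime_foldl_measure _ _ _ _ _ _ _ size (fun n => (n.+2 ^ k).+2)
  (fun x acc (b : bool) => add_bits (false :: acc) (if b then f x else [::]))) => //.
- exact: bsize_bits.
- by poly_bounded.
- move=> x acc b; rewrite size_add_carry size_cat size_nseq /=.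
  have : size (f x) <= (bsize x).+2 ^ k.
    by apply: leq_trans (Hk x); case/andP: (bsize_bits (f x)).
  have : (bsize x).+2 ^ k <= (bsize x + bsize b).+2 ^ k.
    by case: (k) => // k'; rewrite leq_exp2r // !ltnS leq_addr.
  by case: b => /=; set u1 := _ ^ k; set u2 := _ ^ k; lia.
- apply: ptime_add_bits; ptime.
  by apply: (ptime_comp (g := f)) => //; ptime.
- by ptime.
Qed.

Lemma ptime_leq_bits T (dT : Data T) (f g : T -> seq bool) :
  ptime f -> ptime g -> ptime (fun x => leq_bits (f x) (g x)).
Proof.
move=> pf pg.
pose F (_ : T) (s : seq bool * bool) (x : bool) :=
  (behead s.1, if x == head false s.1 then s.2 else head false s.1).
pose F' x := foldl (F x) (g x, true) (f x ++ nseq (size (g x)) false).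
apply: (@eq_ptime _ _ _ _ _ (fun x => (F' x).2)).
  move=> x; rewrite /F' /leq_bits; move: (_ ++ _) => xs.
  by elim: xs (g x) true => [|y xs IH] ys r //=; rewrite IH.
have pF : ptime F'.
  apply: (@ptime_foldl _ _ _ _ _ _ _ (fun=> 20)) => //.
  - by poly_bounded.
  - move=> t0 [ys r] x; rewrite /F /= !bsize_pair.
    set u := (if _ then _ else _); have := bsize_bool u.
    move: (bsize u) => nu {u}.
    by case: ys => [|y ys] /=; rewrite ?bsize_cons; lia.
  - by rewrite /F; ptime.
  - by ptime.
  - by ptime_nat.
by ptime_nat.
Qed.

Lemma ptime_literal_le T (dT : Data T) (f g : T -> literal) :
  ptime f -> ptime g -> ptime (fun x => literal_le (f x) (g x)).
Proof.
move=> pf pg.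
have px : ptime (fun x => mul_bits (rev (f x).2.1) (g x).2.2).
  by apply: ptime_mul_bits; ptime_nat.
have py : ptime (fun x => mul_bits (rev (g x).2.1) (f x).2.2).
  by apply: ptime_mul_bits; ptime_nat.
apply: ptime_if; first by ptime.
  by apply: ptime_if; [ptime | apply: ptime_leq_bits | ptime].
apply: ptime_if; first by ptime.
  by apply: ptime_and; apply: ptime_not; apply: ptime_has => //; ptime.
exact: ptime_leq_bits.
Qed.

Lemma ptime_entry T (dT : Data T) (f : T -> seq (seq literal)) i j :
  ptime f -> ptime i -> ptime j -> ptime (fun x => entry (f x) (i x) (j x)).
Proof. by move=> pf pi pj; rewrite /entry; ptime_nat. Qed.

End ComparisonTime.

Ltac ptime_hook ::= first
  [ apply: ptime_literal_le | apply: ptime_entry ].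

Section RoundTime.

Variable Sigma : finType.
Local Notation ptime := (@ptime Sigma _ _ _ _).

Definition game : Type := (nat * nat) * (seq (seq literal) * seq (seq literal)).

Lemma ptime_row_dominatedb :
  ptime (fun p : game * (seq bool * seq bool) * nat =>
    row_dominatedb p.1.1.1.1 p.1.1.1.2 p.1.1.2.1 p.1.2.1 p.1.2.2 p.2).
Proof. by rewrite /row_dominatedb; ptime_nat. Qed.

Lemma ptime_col_dominatedb :
  ptime (fun p : game * (seq bool * seq bool) * nat =>
    col_dominatedb p.1.1.1.1 p.1.1.1.2 p.1.1.2.2 p.1.2.1 p.1.2.2 p.2).
Proof. by rewrite /col_dominatedb; ptime_nat. Qed.

(** Whatever the current masks are, a round returns masks of lengths [n] and [m]. Both numbers stand
    in unary in the context, which therefore bounds the size of the new accumulator. *)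
Lemma ptime_elimination :
  ptime (fun G : game => elimination G.1.1 G.1.2 G.2.1 G.2.2).
Proof.
apply: (@ptime_foldl _ _ _ _ _ _ _ (fun n => 20 * n + 20)
  (fun (G : game) (S : seq bool * seq bool) (_ : nat) =>
     elimination_round G.1.1 G.1.2 G.2.1 G.2.2 S.1 S.2)).
- by poly_bounded.
- move=> [[n m] AB] S i; rewrite /elimination_round /= bsize_pair.
  set u := [seq _ | _ <- _]; set v := [seq _ | _ <- _].
  have := bsize_bits u; have := bsize_bits v.
  rewrite !size_map !size_iota !bsize_pair !bsize_nat.
  by move: (bsize u) (bsize v) => nu nv; lia.
- rewrite /elimination_round; apply: ptime_pair.
    apply: ptime_map; last by ptime_nat.
    apply: ptime_and; first by ptime_nat.
    apply: ptime_not; apply: (ptime_comp (f := fun q : game * (_ * nat) * nat =>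
      (q.1.1, q.1.2.1, q.2)) ptime_row_dominatedb); ptime.
  apply: ptime_map; last by ptime_nat.
  apply: ptime_and; first by ptime_nat.
  apply: ptime_not; apply: (ptime_comp (f := fun q : game * (_ * nat) * nat =>
      (q.1.1, q.1.2.1, q.2)) ptime_col_dominatedb); ptime.
- by ptime_nat.
- by ptime_nat.
Qed.

End RoundTime.

Section DecisionTime.

Variable Sigma : finType.
Local Notation ptime := (@ptime Sigma _ _ _ _).

Lemma ptime_eq_symbol T (dT : Data T) (f g : T -> symbol) :
  ptime f -> ptime g -> ptime (fun x => f x == g x).
Proof.
move=> pf pg; apply: (@eq_ptime _ _ _ _ _ (fun x =>
    nat_of_ord (symbol_code (f x)) == nat_of_ord (symbol_code (g x)))).
  by move=> x; rewrite (inj_eq val_inj) (inj_eq (can_inj symbol_codeK)).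
have pcode (h : T -> symbol) : ptime h -> ptime (fun x => nat_of_ord (symbol_code (h x))).
  by apply: (@ptime_comp _ _ _ _ _ _ _ (fun s => nat_of_ord (symbol_code s))); apply: ptime_cast.
by apply: ptime_eqn; apply: pcode.
Qed.

Lemma ptime_pieces T (dT : Data T) sep (w : T -> seq symbol) :
  ptime w -> ptime (fun x => pieces sep (w x)).
Proof.
move=> pw; apply: (@ptime_foldr _ _ _ (seq (seq symbol)) symbol _ _ (fun n => n + 3) (fun _ a s =>
  if a == sep then [::] :: s else (a :: head [::] s) :: behead s)) => //.
- by poly_bounded.
- have E0 : bsize ([::] : seq symbol) = 1 by [].
  have E1 : bsize ([::] : seq (seq symbol)) = 1 by [].
  move=> x a s; case: ifP => _; rewrite !bsize_cons ?E0 ?E1; first by lia.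
  by case: s => [|b s] /=; rewrite ?bsize_cons ?E0 ?E1; lia.
- apply: ptime_if; first (apply: ptime_eq_symbol); by ptime.
- by ptime.
Qed.

Lemma ptime_parse_literal T (dT : Data T) (e : T -> seq symbol) :
  ptime e -> ptime (fun x => parse_literal (e x)).
Proof.
move=> pe; have pneg : ptime (fun x => head Zero (e x) == Minus).
  by apply: ptime_eq_symbol; ptime.
have pp : ptime (fun x => pieces Slash
    (if head Zero (e x) == Minus then behead (e x) else e x)).
  by apply: ptime_pieces; ptime.
by apply: ptime_pair => //; apply: ptime_pair; apply: ptime_map;
  solve [apply: ptime_eq_symbol; ptime | ptime_nat].
Qed.

Lemma ptime_parse_matrix T (dT : Data T) (w : T -> seq symbol) :
  ptime w -> ptime (fun x => parse_matrix (w x)).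
Proof.
move=> pw; apply: ptime_map; last exact: ptime_pieces.
apply: ptime_map; last by apply: ptime_pieces; ptime.
by apply: ptime_parse_literal; ptime.
Qed.

Lemma ptime_parse_instance : ptime parse_instance.
Proof.
have pp : ptime (fun w => pieces Hash w) by apply: ptime_pieces; ptime.
apply: ptime_pair; first by ptime_nat.
by apply: ptime_pair; apply: ptime_parse_matrix; ptime_nat.
Qed.

Lemma ptime_unparse_matrix T (dT : Data T) (M : T -> seq (seq literal)) :
  ptime M -> ptime (fun x => unparse_matrix (M x)).
Proof.
by move=> pM; rewrite /unparse_matrix; ptime_nat.
Qed.

Lemma ptime_unparse_instance : ptime unparse_instance.
Proof.
rewrite /unparse_instance; ptime_nat; apply: ptime_unparse_matrix; ptime.
Qed.

Lemma ptime_decide : ptime decide.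
Proof.
have pv : ptime (fun p : seq symbol * instance => valid p.1 p.2 && eliminatedb p.2).
  apply: ptime_and.
    apply: ptime_and.
      apply: ptime_eq_seq.
      - by apply: ptime_eq_symbol; ptime.
      - by ptime.
      - by apply: (ptime_comp ptime_unparse_instance); ptime.
    by ptime_nat.
  apply: ptime_not; apply: ptime_nth; last by ptime_nat.
  apply: ptime_fst; apply: (ptime_comp (f := fun p : seq symbol * instance =>
    ((size p.2.2.1, size (head [::] p.2.2.1)), (p.2.2.1, p.2.2.2)))
    (ptime_elimination Sigma)).
  by ptime_nat.
apply: (ptime_comp (f := fun w => (w, parse_instance w))) pv _.
by apply: ptime_pair; [ptime | apply: ptime_parse_instance].
Qed.

End DecisionTime.

Lemma decide_in_P : in_P (fun w => decide w).
Proof. exact: ptime_in_P (ptime_decide _). Qed.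

(** * Correctness of the decision procedure *)

Section Elimination.

Local Open Scope ring_scope.

Variables (R : realType) (n m : nat) (A B : 'M[R]_(n, m)).

Definition next_subgame (S : {set 'I_n} * {set 'I_m}) : {set 'I_n} * {set 'I_m} :=
  ([set k in S.1 | ~~ row_dominated A S.1 S.2 k],
   [set l in S.2 | ~~ col_dominated B S.1 S.2 l]).

(** Dominance is tested against [I] and [J], not against what remains after the deletion. So all
    dominated strategies of both players form a removable pair that contains every other one, and it
    is the only maximal pair. *)
Lemma sim_stepE S T : sim_step A B S T = (T == next_subgame S).
Proof.
case: S => I J; rewrite /sim_step /next_subgame /=.
set K0 := [set k in I | row_dominated A I J k].
set L0 := [set l in J | col_dominated B I J l].
have rem0 : removable A B I J K0 L0.
  apply/and4P; split.
  - by apply/fintype.subsetP => k; rewrite inE => /andP[].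
  - by apply/fintype.subsetP => l; rewrite inE => /andP[].
  - by apply/forall_inP => k; rewrite inE => /andP[].
  - by apply/forall_inP => l; rewrite inE => /andP[].
have sub0 K L : removable A B I J K L -> (K \subset K0) && (L \subset L0).
  case/and4P => /fintype.subsetP sK /fintype.subsetP sL /forall_inP dK /forall_inP dL.
  apply/andP; split; apply/fintype.subsetP => x x_in; rewrite inE.
    by rewrite sK // dK.
  by rewrite sL // dL.
have maxE K L : max_removable A B I J K L = (K == K0) && (L == L0).
  apply/andP/andP => [[/sub0/andP[sK sL]] /forallP/(_ K0)/forallP/(_ L0)|].
    by rewrite rem0 sK sL /= => /andP[/eqP <- /eqP <-].
  case=> /eqP -> /eqP ->; split => //.
  apply/forallP => K'; apply/forallP => L'; apply/implyP => /and3P[/sub0/andP[sK sL] sK' sL'].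
  by rewrite !eqEsubset sK sL sK' sL'.
have -> : [set k in I | ~~ row_dominated A I J k] = I :\: K0.
  by apply/setP => k; rewrite !inE; case: (k \in I); rewrite ?andbF ?andbT.
have -> : [set l in J | ~~ col_dominated B I J l] = J :\: L0.
  by apply/setP => l; rewrite !inE; case: (l \in J); rewrite ?andbF ?andbT.
apply/existsP/eqP => [[K /existsP[L]]|->].
  by rewrite maxE => /andP[/andP[/eqP -> /eqP ->] /eqP].
by exists K0; apply/existsP; exists L0; rewrite maxE !eqxx.
Qed.

Lemma connect_sim_step S T :
  connect (sim_step A B) S T <-> exists k, T = iter k next_subgame S.
Proof.
have E : sim_step A B =2 frel next_subgame by move=> U V; rewrite sim_stepE eq_sym.
rewrite (eq_connect E); split => [/iter_findex <-|[k ->]].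
  by eexists.
exact: fconnect_iter.
Qed.

(** The measure behind the [n + m] rounds: both components shrink, and equal cardinalities would
    force equal sets. *)
Lemma next_subgame_card S :
  next_subgame S = S \/
  (#|(next_subgame S).1| + #|(next_subgame S).2| < #|S.1| + #|S.2|)%N.
Proof.
have s1 : (next_subgame S).1 \subset S.1 by apply/fintype.subsetP => k; rewrite inE => /andP[].
have s2 : (next_subgame S).2 \subset S.2 by apply/fintype.subsetP => k; rewrite inE => /andP[].
have [c1 c2] := (subset_leqif_cards s1, subset_leqif_cards s2).
case: (eqVneq (next_subgame S) S) => [|neq]; first by left.
right; have [le_c eq_c] := leqif_add c1 c2.
rewrite ltn_neqAle le_c andbT eq_c; apply: contra neq => /andP[/eqP e1 /eqP e2].
by rewrite [next_subgame S]surjective_pairing e1 e2 -surjective_pairing.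
Qed.

Lemma iter_next_subgame_stable k (S : {set 'I_n} * {set 'I_m}) :
  (#|S.1| + #|S.2| <= k)%N ->
  next_subgame (iter k next_subgame S) = iter k next_subgame S.
Proof.
elim: k S => [|k IH] S le_k.
  by case: (next_subgame_card S) => //; lia.
rewrite iterSr; case: (next_subgame_card S) => [fixS|lt_S]; last by apply: IH; lia.
rewrite fixS; have -> : iter k next_subgame S = S by elim: k {IH le_k} => //= k ->.
by [].
Qed.

(** Row sets only shrink, so a row lost at a stage up to [n + m] is still missing at [n + m]; later
    stages agree with that one by stability. *)
Lemma sim_eliminatedE i :
  sim_eliminated A B i <-> i \notin (iter (n + m) next_subgame (setT, setT)).1.
Proof.
split=> [[I [J [/connect_sim_step[k E]]]]|ni]; last first.
  exists (iter (n + m) next_subgame (setT, setT)).1, (iter (n + m) next_subgame (setT, setT)).2.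
  split=> //; apply/connect_sim_step; exists (n + m)%N.
  by rewrite -surjective_pairing.
have -> : I = (iter k next_subgame (setT, setT)).1 by rewrite -E.
apply: contra => {E}.
have sub S : {subset (next_subgame S).1 <= S.1} by move=> x; rewrite inE => /andP[].
have fixed : forall d, iter (d + (n + m)) next_subgame (setT, setT) =
    iter (n + m) next_subgame (setT, setT).
  elim=> //= d ->; apply: iter_next_subgame_stable.
  by rewrite !cardsT !card_ord.
case: (leqP k (n + m)) => [/subnK <-|/ltnW /subnK <-]; last by rewrite fixed.
by rewrite iterD; elim: (_ - k)%N => //= d IH /sub.
Qed.

End Elimination.

(** * Parsing inverts encoding *)

Definition symbol_index (s : symbol) : nat :=
  match s with
  | Zero => 0 | One => 1 | Minus => 2 | Slash => 3 | Comma => 4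
  | Semicolon => 5 | Hash => 6
  end.

(** Unlike [==] on symbols, which goes through the opaque [inord], the right
    hand side computes. *)
Lemma symbol_eqE (a b : symbol) : (a == b) = (symbol_index a == symbol_index b).
Proof. by apply/eqP/eqP => [->//|]; case: a; case: b. Qed.

Lemma cat_pieces sep u v :
  sep \notin u -> pieces sep (rcons u sep ++ v) = u :: pieces sep v.
Proof.
elim: u => [|a u IH] /=; first by rewrite eqxx.
by rewrite inE negb_or eq_sym => /andP[/negPf -> /IH ->].
Qed.

Lemma pieces_flatten sep s :
  all (fun u => sep \notin u) s ->
  pieces sep (flatten [seq rcons u sep | u <- s]) = s.
Proof. by elim: s => //= u s IH /andP[u_sep /IH {2}<-]; apply: cat_pieces. Qed.

(** An unterminated tail is a single piece, except that an empty one yields no piece at all; the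
    default of [nth] then gives the right answer. *)
Lemma pieces_last sep u : sep \notin u -> nth [::] (pieces sep u) 0 = u.
Proof.
elim: u => //= a u IH; rewrite inE negb_or eq_sym => /andP[/negPf -> /IH Eu] /=.
by rewrite -nth0 Eu.
Qed.

Lemma numeral_notin s a : a != Zero -> a != One -> a \notin encode_numeral s.
Proof.
move=> a0 a1; apply/mapP => -[b _ E]; move: a0 a1; rewrite E.
by case: b {E}; rewrite eqxx.
Qed.

Lemma literal_notin e a :
  a \in [:: Comma; Semicolon; Hash] -> a \notin unparse_literal e.
Proof.
rewrite !inE => /or3P[] /eqP ->;
  rewrite mem_cat negb_or mem_cat inE !negb_or !numeral_notin ?symbol_eqE //=;
  by case: e.1; rewrite ?inE ?symbol_eqE.
Qed.

Lemma flatten_rcons_notin T (f : T -> seq symbol) sep a s :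
  a != sep -> (forall x, a \notin f x) ->
  a \notin flatten [seq rcons (f x) sep | x <- s].
Proof.
move=> ne_a fa; elim: s => //= x s IH.
by rewrite mem_cat negb_or mem_rcons inE negb_or ne_a fa.
Qed.

Lemma decode_numeral s : [seq x == One | x <- encode_numeral s] = s.
Proof. by elim: s => //= b s ->; case: b; rewrite symbol_eqE. Qed.

Lemma unparse_literalK : cancel unparse_literal parse_literal.
Proof.
move=> [b [p q]]; rewrite /parse_literal /unparse_literal /=.
(* Without a sign, a literal starts with a digit or, if its numerator is the empty numeral, with
   [Slash]. *)
have Ehead : (head Zero ((if b then [:: Minus] else [::]) ++
    encode_numeral p ++ Slash :: encode_numeral q) == Minus) = b.
  by rewrite symbol_eqE; case: b => //=; case: p => [|[] p].
rewrite Ehead.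
have -> : (if b then behead ((if b then [:: Minus] else [::]) ++
    encode_numeral p ++ Slash :: encode_numeral q)
  else (if b then [:: Minus] else [::]) ++
    encode_numeral p ++ Slash :: encode_numeral q) =
    rcons (encode_numeral p) Slash ++ encode_numeral q.
  by rewrite cat_rcons; case: b {Ehead}.
have Slash_notin s : Slash \notin encode_numeral s by rewrite numeral_notin ?symbol_eqE.
by rewrite cat_pieces //= pieces_last // !decode_numeral.
Qed.

Lemma row_notin r a : a \in [:: Semicolon; Hash] ->
  a \notin flatten [seq rcons (unparse_literal e) Comma | e <- r].
Proof.
move=> a_in; apply: flatten_rcons_notin.
  by move: a_in; rewrite !inE => /orP[] /eqP ->; rewrite symbol_eqE.
by move=> e; apply: literal_notin; rewrite inE a_in orbT.
Qed.

Lemma unparse_matrixK : cancel unparse_matrix parse_matrix.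
Proof.
move=> M; rewrite /parse_matrix /unparse_matrix.
rewrite (map_comp (fun u => rcons u Semicolon)) pieces_flatten; last first.
  by apply/allP => _ /mapP[r _ ->]; apply: row_notin; rewrite !inE !symbol_eqE.
rewrite -map_comp -[RHS]map_id; apply: eq_map => r /=.
rewrite (map_comp (fun u => rcons u Comma)) pieces_flatten; last first.
  by apply/allP => _ /mapP[e _ ->]; apply: literal_notin; rewrite !inE !symbol_eqE.
by rewrite -map_comp -[RHS]map_id; apply: eq_map => e /=; rewrite unparse_literalK.
Qed.

Lemma matrix_notin M : Hash \notin unparse_matrix M.
Proof.
apply: flatten_rcons_notin => [|r]; first by rewrite symbol_eqE.
by apply: row_notin; rewrite !inE !symbol_eqE.
Qed.

Lemma unparse_instanceK : cancel unparse_instance parse_instance.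
Proof.
move=> [i [A B]]; rewrite /parse_instance /unparse_instance /=.
rewrite -!cat_rcons cat_pieces; last first.
  by apply/mapP => -[].
rewrite cat_pieces ?matrix_notin //=.
by rewrite pieces_last ?matrix_notin // !unparse_matrixK size_map size_iota.
Qed.

Definition literal_of (f : fraction_literal) : literal :=
  (lit_neg f, (lit_num f, lit_den f)).

Definition fraction_of (e : literal) : fraction_literal :=
  FractionLiteral e.1 e.2.1 e.2.2.

Definition rows_of n m (M : 'M[fraction_literal]_(n, m)) : seq (seq literal) :=
  [seq [seq literal_of (M i j) | j <- enum 'I_m] | i <- enum 'I_n].

Definition matrix_of n m (M : seq (seq literal)) : 'M[fraction_literal]_(n, m) :=
  (\matrix_(i < n, j < m) fraction_of (entry M i j))%R.

Lemma unparse_rows_of n m (M : 'M[fraction_literal]_(n, m)) :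
  unparse_matrix (rows_of M) = encode_matrix M.
Proof.
rewrite /unparse_matrix /encode_matrix /rows_of -map_comp; congr flatten.
by apply: eq_map => i /=; rewrite -map_comp.
Qed.

Lemma entry_rows_of n m (M : 'M[fraction_literal]_(n, m)) (i : 'I_n) (j : 'I_m) :
  entry (rows_of M) i j = literal_of (M i j).
Proof.
rewrite /entry (nth_map i) ?size_enum_ord // (nth_map j) ?size_enum_ord //.
by rewrite !nth_ord_enum.
Qed.

Lemma matrix_ofK n m (M : seq (seq literal)) :
  size M = n -> all (fun r => size r == m) M -> rows_of (matrix_of n m M) = M.
Proof.
move=> <- /allP szM; apply: (@eq_from_nth _ [::]); rewrite size_map size_enum_ord // => i lti.
rewrite (nth_map (Ordinal lti)) ?size_enum_ord //.
have szi : size (nth [::] M i) = m by apply/eqP/szM/mem_nth.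
apply: (@eq_from_nth _ (false, ([::], [::]))).
  by rewrite size_map size_enum_ord.
rewrite size_map size_enum_ord => j ltj.
rewrite (nth_map (Ordinal ltj)) ?size_enum_ord // mxE.
have -> : nth (Ordinal lti) (enum 'I_(size M)) i = Ordinal lti.
  exact: (nth_ord_enum _ (Ordinal lti)).
have -> : nth (Ordinal ltj) (enum 'I_m) j = Ordinal ltj.
  exact: (nth_ord_enum _ (Ordinal ltj)).
by rewrite /entry /=; case: (nth _ _ j) => b [p q].
Qed.

Lemma rows_of_size n m (M : 'M[fraction_literal]_(n, m)) : size (rows_of M) = n.
Proof. by rewrite size_map size_enum_ord. Qed.

Lemma rows_of_all n m (M : 'M[fraction_literal]_(n, m)) :
  all (fun r => size r == m) (rows_of M).
Proof. by apply/allP => _ /mapP[i _ ->]; rewrite size_map size_enum_ord. Qed.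

(** * Agreement of the Boolean tests with real payoffs *)

Section Value.

Local Open Scope ring_scope.
Variable R : realType.

Lemma binary_value_eq0 s : (binary_value s == 0)%N = ~~ has id s.
Proof. by rewrite -bit_value_rev bit_value_eq0 has_rev. Qed.

Lemma literal_leE (f g : fraction_literal) :
  binary_value (lit_den f) != 0%N -> binary_value (lit_den g) != 0%N ->
  literal_le (literal_of f) (literal_of g) =
  (literal_value R f <= literal_value R g).
Proof.
case: f g => [a p q] [b r s] /= q0 s0; rewrite /literal_le /literal_value /=.
rewrite -!bit_value_eq0 !leq_bits_value !mul_bits_value !bit_value_rev.
have q_gt0 : 0 < (binary_value q)%:R :> R by rewrite ltr0n lt0n.
have s_gt0 : 0 < (binary_value s)%:R :> R by rewrite ltr0n lt0n.
rewrite ler_pdivrMr // mulrAC ler_pdivlMr // -!mulrA -!natrM.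
set x := (binary_value p * _)%N; set y := (binary_value r * _)%N.
case: a; case: b; rewrite /= ?expr0 ?expr1 ?mul1r ?mulN1r.
- by rewrite lerN2 ler_nat.
- by rewrite (le_trans (y := 0)) // ?oppr_le0 ler0n.
(* The mixed case [x <= - y]: for natural numbers this means [x + y = 0], so both products
   vanish. *)
- by rewrite -subr_ge0 -opprD oppr_ge0 -natrD lern0 addn_eq0 andbC.
- by rewrite ler_nat.
Qed.

End Value.

Definition mask_of n (I : {set 'I_n}) : seq bool := [seq i \in I | i <- enum 'I_n].

Lemma nth_mask_of n (I : {set 'I_n}) (i : 'I_n) : nth false (mask_of I) i = (i \in I).
Proof. by rewrite (nth_map i) ?size_enum_ord // nth_ord_enum. Qed.

Lemma map_iota_ord T n (f : nat -> T) : [seq f i | i <- iota 0 n] = [seq f i | i : 'I_n].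
Proof. by rewrite -val_enum_ord -map_comp. Qed.

Lemma has_iota_ord n (p : pred nat) : has p (iota 0 n) = [exists i : 'I_n, p i].
Proof.
rewrite -val_enum_ord has_map; apply/hasP/existsP => [[i _ pi]|[i pi]]; exists i => //.
by rewrite mem_enum.
Qed.

Lemma all_iota_ord n (p : pred nat) : all p (iota 0 n) = [forall i : 'I_n, p i].
Proof.
rewrite -val_enum_ord all_map; apply/allP/forallP => pi i; last by move=> _; apply: pi.
by apply: pi; rewrite mem_enum.
Qed.

Section Masks.

Local Open Scope ring_scope.

Variables (R : realType) (n m : nat) (A B : 'M[fraction_literal]_(n, m)).
Hypotheses (properA : proper_literals A) (properB : proper_literals B).

Let AR := map_mx (@literal_value R) A.
Let BR := map_mx (@literal_value R) B.

Lemma row_dominatedbE (I : {set 'I_n}) (J : {set 'I_m}) (k : 'I_n) :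
  row_dominatedb n m (rows_of A) (mask_of I) (mask_of J) k = row_dominated AR I J k.
Proof.
rewrite /row_dominatedb has_iota_ord; apply: eq_existsb => i; rewrite nth_mask_of.
congr (_ && _); rewrite has_iota_ord; apply: eq_existsb => j0; rewrite nth_mask_of.
congr (_ && _); rewrite all_iota_ord !entry_rows_of (literal_leE R) ?properA //.
rewrite -ltNge !mxE; congr (_ && _); apply: eq_forallb => j.
by rewrite nth_mask_of !entry_rows_of (literal_leE R) ?properA // !mxE.
Qed.

Lemma col_dominatedbE (I : {set 'I_n}) (J : {set 'I_m}) (l : 'I_m) :
  col_dominatedb n m (rows_of B) (mask_of I) (mask_of J) l = col_dominated BR I J l.
Proof.
rewrite /col_dominatedb has_iota_ord; apply: eq_existsb => j; rewrite nth_mask_of.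
congr (_ && _); rewrite has_iota_ord; apply: eq_existsb => i0; rewrite nth_mask_of.
congr (_ && _); rewrite all_iota_ord !entry_rows_of (literal_leE R) ?properB //.
rewrite -ltNge !mxE; congr (_ && _); apply: eq_forallb => i.
by rewrite nth_mask_of !entry_rows_of (literal_leE R) ?properB // !mxE.
Qed.

Lemma elimination_roundE (S : {set 'I_n} * {set 'I_m}) :
  elimination_round n m (rows_of A) (rows_of B) (mask_of S.1) (mask_of S.2) =
  (mask_of (next_subgame AR BR S).1, mask_of (next_subgame AR BR S).2).
Proof.
rewrite /elimination_round !map_iota_ord; congr (_, _); apply: eq_map => k.
  by rewrite nth_mask_of row_dominatedbE inE.
by rewrite nth_mask_of col_dominatedbE inE.
Qed.

Lemma eliminationE :
  elimination n m (rows_of A) (rows_of B) =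
  let S := iter (n + m) (next_subgame AR BR) (setT, setT) in (mask_of S.1, mask_of S.2).
Proof.
rewrite /elimination !map_iota_ord.
have maskT p : [seq true | _ : 'I_p] = mask_of [set: 'I_p].
  by apply: eq_map => i; rewrite inE.
have gen (l : seq nat) (S : {set 'I_n} * {set 'I_m}) :
    foldl (fun S (_ : nat) => elimination_round n m (rows_of A) (rows_of B) S.1 S.2)
      (mask_of S.1, mask_of S.2) l =
    let T := iter (size l) (next_subgame AR BR) S in (mask_of T.1, mask_of T.2).
  by elim: l S => [|_ l IH] S //=; rewrite elimination_roundE IH /= -iterSr.
by rewrite !maskT (gen _ ([set: 'I_n], [set: 'I_m])) size_iota.
Qed.

End Masks.

Lemma map_const_iota T (x : T) p q : [seq x | _ <- iota p q] = nseq q x.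
Proof. by elim: q p => //= q IH p; rewrite IH. Qed.

(** If the test succeeds, validity makes the parsed lists rectangular, so they are the rows of
    matrices whose encoding is [w]. Conversely, parsing a correct encoding recovers its rows exactly
    and every validity condition holds. *)
Lemma decideP (R : realType) w : decide w <-> Simultaneous R w.
Proof.
rewrite /decide /eliminatedb; split.
  case: (parse_instance w) => i1 [A B] /=.
  move=> /andP[/and5P[/eqP Ew /= i_gt0 le_i /eqP szB]].
  set m := size (head [::] A); set n := size A in le_i szB *.
  rewrite !all_cat => /andP[/andP[rA rB] /andP[dA dB]].
  have lt_i : i1.-1 < n by lia.
  have KA : rows_of (matrix_of n m A) = A by apply: matrix_ofK.
  have KB : rows_of (matrix_of n m B) = B by apply: matrix_ofK.
  have proper M : size M = n -> all (fun r => size r == m) M ->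
      all (fun r => all (fun e : literal => has id e.2.2) r) M ->
      proper_literals (matrix_of n m M).
    move=> szM /allP rM /allP dM i j; rewrite mxE /= binary_value_eq0 negbK.
    have in_M : nth [::] M i \in M by apply: mem_nth; rewrite szM.
    by apply: (allP (dM _ in_M)); apply: mem_nth; rewrite (eqP (rM _ in_M)).
  have pA := proper _ (erefl n) rA dA; have pB := proper _ szB rB dB.
  rewrite -{1}KA -{1}KB (eliminationE R pA pB) /=.
  rewrite -[i1.-1]/(nat_of_ord (Ordinal lt_i)) nth_mask_of => ni.
  exists n, m, (matrix_of n m A), (matrix_of n m B), (Ordinal lt_i); split => //.
    by rewrite Ew /encode_instance -!unparse_rows_of KA KB -(map_const_iota _ 0) prednK.
  exact/sim_eliminatedE.
case=> n [m [A [B [i [pA pB -> elim_i]]]]].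
have -> : encode_instance A B i = unparse_instance (i.+1, (rows_of A, rows_of B)).
  by rewrite /encode_instance -!unparse_rows_of -(map_const_iota _ 0).
rewrite unparse_instanceK /= !rows_of_size.
(* The number of columns is read off the first row, which exists because [i] is a row index. *)
have -> : size (head [::] (rows_of A)) = m.
  rewrite -nth0; apply/eqP/(allP (rows_of_all A))/mem_nth.
  by rewrite rows_of_size; apply: leq_trans (ltn_ord i).
rewrite (eliminationE R pA pB) nth_mask_of; move/sim_eliminatedE: elim_i => ->.
rewrite andbT /valid /= eqxx !rows_of_size ltn_ord eqxx !all_cat.
have -> : size (head [::] (rows_of A)) = m.
  rewrite -nth0; apply/eqP/(allP (rows_of_all A))/mem_nth.
  by rewrite rows_of_size; apply: leq_trans (ltn_ord i).
rewrite !rows_of_all /=.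
have proper M : proper_literals M ->
    all (fun r => all (fun e : literal => has id e.2.2) r) (@rows_of n m M).
  move=> pM; apply/allP => _ /mapP[k _ ->]; apply/allP => _ /mapP[l _ ->] /=.
  by have := pM k l; rewrite binary_value_eq0 negbK.
by rewrite !proper.
Qed.

Theorem theorem6p2 (R : realType) : in_P (Simultaneous R).
Proof.
have [M [k Hk]] := decide_in_P; exists M, k => w.
have [b [Hv Hb]] := Hk w; exists b; split => //.
by rewrite Hb; apply: decideP.
Qed.
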